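(* Let $\mathbb F$ be $\mathbb R$ or $\mathbb C$, and let $I,K,R$ be positive integers such that $$2\leq I\leq K\leq R,\qquad R\leq \frac{2I+2K+1-\sqrt{8K+8I+1}}{2},$$ or equivalently $$m-1\leq I\leq K\leq R,\qquad R\leq \frac{I^2+(3-2m)I}{2}+\frac{(m-1)(m-2)}{2},$$ where $m=R-K+2$. Then the SFS-CPD of an $I\times I\times K$ tensor of SFS-rank $R$ (over $\mathbb F$) is generically unique.
   Context: An SFS-tensor is a tensor $\mathcal T=(t_{ijk})\in\mathbb F^{I\times I\times K}$ whose frontal slices $(t_{ijk})_{i,j}$ are symmetric matrices for every $k$. A rank-1 SFS-tensor is one of the form $\mathbf a\circ\mathbf a\circ\mathbf c$ with nonzero $\mathbf a\in\mathbb F^I$, $\mathbf c\in\mathbb F^K$, where $\circ$ is the outer product, i.e. its entries are $a_ia_jc_k$. For $\mathbf A=[\mathbf a_1\ \dots\ \mathbf a_R]\in\mathbb F^{I\times R}$ and $\mathbf C=[\mathbf c_1\ \dots\ \mathbf c_R]\in\mathbb F^{K\times R}$ write $[\mathbf A,\mathbf A,\mathbf C]_R=\sum_{r=1}^R\mathbf a_r\circ\mathbf a_r\circ\mathbf c_r$. The SFS-rank of an SFS-tensor $\mathcal T$ is the minimal number of rank-1 SFS-tensors (over $\mathbb F$) whose sum is $\mathcal T$; a decomposition of $\mathcal T$ into this minimal number of rank-1 SFS-terms is called an SFS-CPD of $\mathcal T$. The SFS-CPD of $\mathcal T$ is unique if it is only subject to permutation of the rank-1 terms and to rescaling of the vectors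 within a rank-1 term that leaves the term unchanged (i.e. the collection of rank-1 SFS-terms is uniquely determined up to order). Let $\mu_{\mathbb F}$ be the Lebesgue measure on $\mathbb F^{I\times R}\times\mathbb F^{K\times R}$. The SFS-CPD of an $I\times I\times K$ tensor of SFS-rank $R$ is generically unique if $$\mu_{\mathbb F}\{(\mathbf A,\mathbf C):\ \text{the SFS-CPD of the tensor } [\mathbf A,\mathbf A,\mathbf C]_R \text{ is not unique}\}=0.$$ *)

(* Defs.v *)
From HB Require Import structures.
From mathcomp Require Import all_boot all_order all_algebra.
From mathcomp Require Import all_classical all_reals all_analysis.
From mathcomp Require Export complex.

Set Implicit Arguments.
Unset Strict Implicit.
Unset Printing Implicit Defensive.

Import Order.TTheory GRing.Theory Num.Theory.

Local Open Scope classical_set_scope.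
Local Open Scope ring_scope.

(* A tensor in F^(I x J x K) is the finite family of its K frontal slices:
   t_{ijk} is T k i j. *)

Definition outer3 (F : fieldType) (I J K : nat)
    (a : 'cV[F]_I) (b : 'cV[F]_J) (c : 'cV[F]_K) : {ffun 'I_K -> 'M[F]_(I, J)} :=
  [ffun k => \matrix_(i, j) (a i 0 * b j 0 * c k 0)].

Definition polyadic (F : fieldType) (I J K R : nat) (A : 'M[F]_(I, R))
    (B : 'M[F]_(J, R)) (C : 'M[F]_(K, R)) : {ffun 'I_K -> 'M[F]_(I, J)} :=
  \sum_(r < R) outer3 (col r A) (col r B) (col r C).

Definition is_rank1_sfs (F : fieldType) (I K : nat)
    (T : {ffun 'I_K -> 'M[F]_I}) : Prop :=
  exists (a : 'cV[F]_I) (c : 'cV[F]_K), [/\ a != 0, c != 0 & T = outer3 a a c].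

Definition is_sfs_decomposition (F : fieldType) (I K : nat)
    (T : {ffun 'I_K -> 'M[F]_I}) (s : seq {ffun 'I_K -> 'M[F]_I}) : Prop :=
  (forall t, t \in s -> is_rank1_sfs t) /\ T = \sum_(t <- s) t.

Definition is_sfs_rank (F : fieldType) (I K : nat)
    (T : {ffun 'I_K -> 'M[F]_I}) (n : nat) : Prop :=
  (exists s, is_sfs_decomposition T s /\ size s = n) /\
  (forall s, is_sfs_decomposition T s -> (n <= size s)%N).

Definition is_sfs_cpd (F : fieldType) (I K : nat)
    (T : {ffun 'I_K -> 'M[F]_I}) (s : seq {ffun 'I_K -> 'M[F]_I}) : Prop :=
  is_sfs_decomposition T s /\ is_sfs_rank T (size s).

(* Comparing the rank-1 terms themselves, rather than the vectors they are
   made of, absorbs the rescalings that leave a term unchanged. *)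
Definition sfs_cpd_unique (F : fieldType) (I K : nat)
    (T : {ffun 'I_K -> 'M[F]_I}) : Prop :=
  forall s1 s2, is_sfs_cpd T s1 -> is_sfs_cpd T s2 -> perm_eq s1 s2.

Section LebesgueTuple.
Context {R : realType}.

Let cons_pair n (p : measurableTypeR R * n.-tuple (measurableTypeR R)) :
  n.+1.-tuple (measurableTypeR R) := [tuple of p.1 :: p.2].

Let measurable_cons_pair n : measurable_fun setT (@cons_pair n).
Proof. exact: measurable_cons. Qed.

Section Step.
Variable (n : nat).
Variable mu : {sigma_finite_measure set (n.-tuple (measurableTypeR R)) -> \bar R}.

(* The image of the product measure lebesgue_measure \x mu under the
   identification R * R^n = R^(n+1). *)
Definition lebesgue_tuple_step : set (n.+1.-tuple (measurableTypeR R)) -> \bar R :=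
  pushforward (product_measure1 (@lebesgue_measure R) mu) (@cons_pair n).

Let step0 : lebesgue_tuple_step set0 = 0%E.
Proof. by rewrite /lebesgue_tuple_step /pushforward preimage_set0 measure0. Qed.

Let step_ge0 A : (0 <= lebesgue_tuple_step A)%E.
Proof. by rewrite /lebesgue_tuple_step /pushforward; exact: measure_ge0. Qed.

Let step_sigma_additive : semi_sigma_additive lebesgue_tuple_step.
Proof.
move=> F mF tF mUF; rewrite /lebesgue_tuple_step /pushforward preimage_bigcup.
have mpre A : measurable A -> measurable (@cons_pair n @^-1` A).
  by move=> mA; rewrite -[X in measurable X]setTI; exact: measurable_cons_pair.
apply: measure_semi_sigma_additive => [i||].
- by apply: mpre; exact: mF.
- apply/trivIsetP => i j _ _ ij; rewrite -preimage_setI.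
  by move/trivIsetP : tF => /(_ _ _ _ _ ij) ->//; rewrite preimage_set0.
- by rewrite -preimage_bigcup; exact: mpre.
Qed.

HB.instance Definition _ := isMeasure.Build _ _ _
  lebesgue_tuple_step step0 step_ge0 step_sigma_additive.

Let step_sigma_finite : sigma_finite setT lebesgue_tuple_step.
Proof.
have [F TF Foo] : sigma_finite setT (product_measure1 (@lebesgue_measure R) mu).
  have /sigma_finiteP[F [TF ndF Foo]] := sigma_finiteT (@lebesgue_measure R).
  have /sigma_finiteP[G [TG ndG Goo]] := sigma_finiteT mu.
  exists (fun i => F i `*` G i) => [|i].
    rewrite -setXTT TF TG predeqE => -[x y]; split=> [[[i _ Fix] [j _ Gjy]]|].
      exists (maxn i j) => //; split.
      - by move: Fix; exact/subsetPset/ndF/leq_maxl.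
      - by move: Gjy; exact/subsetPset/ndG/leq_maxr.
    by move=> [i _ [] ? ?]; split; exists i.
  have [mF Fioo] := Foo i; have [mG Gioo] := Goo i.
  split; first exact: measurableX.
  by rewrite product_measure1E// lte_mul_pinfty// ge0_fin_numE.
pose uncons (t : n.+1.-tuple (measurableTypeR R)) := (thead t, [tuple of behead t]).
have muncons : measurable_fun setT uncons.
  apply: measurable_fun_pair; first exact: measurable_tnth.
  exact: measurable_behead.
have unconsK : cancel (@cons_pair n) uncons.
  move=> [x t]; congr pair; rewrite ?theadE//.
  exact: val_inj.
exists (fun i => uncons @^-1` F i).
  by rewrite -preimage_bigcup -TF preimage_setT.
move=> i; have [mFi Fioo] := Foo i; split.
  by rewrite -[X in measurable X]setTI; exact: muncons.
rewrite /lebesgue_tuple_step /pushforward -comp_preimage.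
rewrite (_ : uncons \o _ = id) ?preimage_id//.
by apply/funext => p /=; exact: unconsK.
Qed.

HB.instance Definition _ := Measure_isSigmaFinite.Build _ _ _
  lebesgue_tuple_step step_sigma_finite.

End Step.

Fixpoint lebesgue_tuple (n : nat) :
    {sigma_finite_measure set (n.-tuple (measurableTypeR R)) -> \bar R} :=
  if n is n'.+1 then lebesgue_tuple_step (lebesgue_tuple n')
  else \d_([tuple] : 0.-tuple (measurableTypeR R)).

End LebesgueTuple.

(* The Lebesgue measure of R^n, read on row vectors.  A set is null when it is
   contained in a Borel set of measure 0, i.e., when it has measure 0 for the
   completed measure. *)
Definition lebesgue_null_real (R : realType) (n : nat) (S : set 'rV[R]_n) :=
  (lebesgue_tuple n).-negligible
    [set v : n.-tuple (measurableTypeR R) | S (\row_j (tnth v j : R))].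

(* C^n = R^n x R^n, by real and imaginary parts. *)
Definition lebesgue_null_complex (R : realType) (n : nat) (S : set 'rV[R[i]]_n) :=
  (lebesgue_tuple (n + n)).-negligible
    [set v : (n + n).-tuple (measurableTypeR R) |
      S (\row_j ((tnth v (lshift n j) : R) +i* (tnth v (rshift n j) : R))%C)].

(* F^(I x R) x F^(K x R) = F^(I * R + K * R); w lists the entries of A, then
   those of C. *)
Definition sfs_cpd_not_unique (F : fieldType) (I K R : nat) :
    set 'rV[F]_(I * R + K * R) :=
  [set w | let A : 'M[F]_(I, R) := vec_mx (lsubmx w) in
           let C : 'M[F]_(K, R) := vec_mx (rsubmx w) in
           ~ sfs_cpd_unique (polyadic A A C)].

Definition sfs_cpd_generically_unique_real (RT : realType) (I K R : nat) : Prop :=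
  lebesgue_null_real (@sfs_cpd_not_unique RT I K R).

Definition sfs_cpd_generically_unique_complex (RT : realType) (I K R : nat) : Prop :=
  lebesgue_null_complex (@sfs_cpd_not_unique (RT[i]) I K R).

(* Main.v *)
Require Import Defs.
From mathcomp Require Import all_boot all_order all_algebra.
From mathcomp Require Import fingroup perm.
From mathcomp Require Import all_classical all_reals all_analysis.
From mathcomp Require Import measurable_realfun.
From mathcomp Require Import zify ring lra.

(** Contracting the tensor of [(A, C)] with a vector [x] along its third mode
    gives the symmetric matrix [A diag(x C) A^T], a combination of the matrices
    [a_r a_r^T].  Put [q = R - K + 1] and [p = I - q = I + K - R - 1].  Both
    forms of the bound say that [R <= 'C(p + 1, 2)].

    The decomposition is unique as soon as any [K] columns of [C] are
    independent and any combination of the [a_r a_r^T] of rank at most [q]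
    involves at most [q] of them ([no_low_rank]).  Let [(A', C')] be another
    decomposition with at most [R] terms.  If [x <> 0] is orthogonal to [K - 1]
    columns of [C'], the contraction with [x] has rank at most [q], so [x] is
    orthogonal to [K - 1] columns of [C].  Hence the hyperplanes spanned by
    columns of [C'] are spanned by columns of [C], and Kruskal's permutation
    argument goes down from hyperplanes to lines: the columns of [C'] are those
    of [C] up to order and scale ([columns_proportional]).  Comparing the
    contractions again identifies the columns of [A'] ([factors_proportional]).

    Both properties hold outside a null set, by a count of parameters.  Suppose
    that [A diag(lam) A^T] has rank at most [q] although [lam] has more than [q]
    nonzero entries.  Then [N A diag(lam) A^T = 0] for a [p x I] matrix [N] of
    rank [p], so that the rows of [N A] span an isotropic subspace for the
    quadratic form [lam], orthogonal to the rows of [A].  The isotropy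
    conditions are quadratic, but the diagonal ones can be solved for [p] of the
    [lam_r], and then everything is a rational function of
    [I R + R - 1 - 'C(p + 1, 2)] parameters ([degenerate_gram_dependent]).  Under
    the bound these are fewer than the [I R] entries of [A], so the entries
    satisfy a polynomial relation ([algebraic_relation]), whose zero set is null
    by Fubini's theorem ([tuple_poly_zeros_null]).  Over the complex numbers,
    taking real and imaginary parts doubles both counts. *)

Set Implicit Arguments.
Unset Strict Implicit.
Unset Printing Implicit Defensive.

Import Order.TTheory GRing.Theory Num.Theory.

Local Open Scope ring_scope.

(** * Rational functions of a family of functions *)

Section RationalFunctions.
Variables (F : fieldType) (Omega : Type) (Gamma : finType).
Variable g : Gamma -> Omega -> F.

(** Only functions without zeros are inverted, so a member of the closure is a
    quotient of two polynomials on the whole of [Omega]. *)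
Inductive rational_in : (Omega -> F) -> Prop :=
| rational_cst c : rational_in (fun=> c)
| rational_gen i : rational_in (g i)
| rational_add a b : rational_in a -> rational_in b ->
    rational_in (fun w => a w + b w)
| rational_mul a b : rational_in a -> rational_in b ->
    rational_in (fun w => a w * b w)
| rational_inv a : (forall w, a w != 0) -> rational_in a ->
    rational_in (fun w => (a w)^-1).

Lemma rational_eq a b : a =1 b -> rational_in a -> rational_in b.
Proof. by move=> /funext ->. Qed.

Lemma rational_opp a : rational_in a -> rational_in (fun w => - a w).
Proof.
move=> ra; apply: (@rational_eq (fun w => -1 * a w)) => [w|].
  by rewrite mulN1r.
by apply: rational_mul => //; exact: rational_cst.
Qed.

Lemma rational_sum (T : Type) (s : seq T) (P : pred T) (a : T -> Omega -> F) :
  (forall t, P t -> rational_in (a t)) ->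
  rational_in (fun w => \sum_(t <- s | P t) a t w).
Proof.
move=> ra; elim: s => [|t s IHs].
  by apply: rational_eq (rational_cst 0) => w; rewrite big_nil.
have [Pt|nPt] := boolP (P t).
  apply: rational_eq (rational_add (ra t Pt) IHs) => w.
  by rewrite big_cons Pt.
by apply: rational_eq IHs => w; rewrite big_cons (negbTE nPt).
Qed.

(** The exponent of each variable is bounded separately, so that these
    functions are spanned by [(D + 1) ^ #|Gamma|] monomials. *)
Definition polynomial_in D (f : Omega -> F) := exists c : {ffun Gamma -> 'I_D.+1} -> F,
  forall w, f w = \sum_e c e * \prod_i g i w ^+ e i.

Lemma polynomial_eq D a b : a =1 b -> polynomial_in D a -> polynomial_in D b.
Proof. by move=> /funext ->. Qed.

Lemma polynomial_monomial D (k : Gamma -> nat) :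
  (forall i, k i <= D)%N -> polynomial_in D (fun w => \prod_i g i w ^+ k i).
Proof.
move=> kD; exists (fun e => (e == [ffun i => inord (k i)])%:R) => w.
rewrite (bigD1 [ffun i => inord (k i)]) //= eqxx mul1r [X in _ + X]big1 ?addr0; last first.
  by move=> e /negbTE ->; rewrite mul0r.
by apply: eq_bigr => i _; rewrite ffunE inordK // ltnS.
Qed.

Lemma polynomial_add D a b : polynomial_in D a -> polynomial_in D b ->
  polynomial_in D (fun w => a w + b w).
Proof.
move=> [c ca] [c' cb]; exists (fun e => c e + c' e) => w.
by rewrite ca cb -big_split; apply: eq_bigr => e _; rewrite mulrDl.
Qed.

Lemma polynomial_scale D k a : polynomial_in D a ->
  polynomial_in D (fun w => k * a w).
Proof.
move=> [c ca]; exists (fun e => k * c e) => w.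
by rewrite ca mulr_sumr; apply: eq_bigr => e _; rewrite mulrA.
Qed.

Lemma polynomial_sum D (T : Type) (s : seq T) (a : T -> Omega -> F) :
  (forall t, polynomial_in D (a t)) ->
  polynomial_in D (fun w => \sum_(t <- s) a t w).
Proof.
move=> pa; elim: s => [|t s IHs].
  by exists (fun=> 0) => w; rewrite big_nil big1 // => e _; rewrite mul0r.
by apply: polynomial_eq (polynomial_add (pa t) IHs) => w; rewrite big_cons.
Qed.

Lemma polynomial_mul D D' a b : polynomial_in D a -> polynomial_in D' b ->
  polynomial_in (D + D') (fun w => a w * b w).
Proof.
move=> [c ca] [c' cb].
apply: (@polynomial_eq _ (fun w => \sum_e \sum_e'
   (c e * c' e') * \prod_i g i w ^+ (e i + e' i))) => [w|].
  rewrite ca cb mulr_suml; apply: eq_bigr => e _; rewrite mulr_sumr.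
  apply: eq_bigr => e' _; rewrite mulrACA -big_split /=; congr (_ * _).
  by apply: eq_bigr => i _; rewrite exprD.
apply: polynomial_sum => e; apply: polynomial_sum => e'.
apply: polynomial_scale; apply: polynomial_monomial => i.
by rewrite leq_add // -ltnS ltn_ord.
Qed.

Lemma polynomial_cst D c : polynomial_in D (fun=> c).
Proof.
have := polynomial_scale c (@polynomial_monomial D (fun=> 0%N) (fun=> isT)).
by apply: polynomial_eq => w; rewrite big1 ?mulr1.
Qed.

Lemma polynomial_widen D D' a : (D <= D')%N -> polynomial_in D a ->
  polynomial_in D' a.
Proof.
move=> /subnKC <- pa.
apply: polynomial_eq (polynomial_mul pa (polynomial_cst (D' - D) 1)) => w.
by rewrite mulr1.
Qed.

Lemma polynomial_exp D a k : polynomial_in D a ->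
  polynomial_in (k * D) (fun w => a w ^+ k).
Proof.
move=> pa; elim: k => [|k IHk].
  by apply: polynomial_eq (polynomial_cst _ 1) => w; rewrite expr0.
rewrite mulSn; apply: polynomial_eq (polynomial_mul pa IHk) => w.
by rewrite exprS.
Qed.

Lemma polynomial_prod D (T : finType) (a : T -> Omega -> F) :
  (forall t, polynomial_in D (a t)) ->
  polynomial_in (#|T| * D) (fun w => \prod_t a t w).
Proof.
move=> pa; rewrite cardE.
have -> : (fun w => \prod_t a t w) = (fun w => \prod_(t <- enum T) a t w).
  by apply/funext => w; rewrite big_enum.
elim: (enum T) => [|t s IHs].
  by apply: polynomial_eq (polynomial_cst _ 1) => w; rewrite big_nil.
rewrite /= mulSn; apply: polynomial_eq (polynomial_mul (pa t) IHs) => w.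
by rewrite big_cons.
Qed.

Lemma rational_fraction f : rational_in f -> exists D P Q,
  [/\ polynomial_in D P, polynomial_in D Q
    & forall w, Q w != 0 /\ f w * Q w = P w].
Proof.
elim=> [c|i|a b _ [Da [Pa [Qa [pPa pQa aE]]]] _ [Db [Pb [Qb [pPb pQb bE]]]]|
        a b _ [Da [Pa [Qa [pPa pQa aE]]]] _ [Db [Pb [Qb [pPb pQb bE]]]]|
        a a0 _ [D [P [Q [pP pQ aE]]]]].
- exists 0%N, (fun=> c), (fun=> 1); split; try exact: polynomial_cst.
  by move=> w; rewrite oner_neq0 mulr1.
- exists 1%N, (g i), (fun=> 1); split; last 1 first.
  + by move=> w; rewrite oner_neq0 mulr1.
  + apply: polynomial_eq (@polynomial_monomial 1%N (fun j => (j == i)%N) _) => [w|j].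
      rewrite (bigD1 i) //= eqxx expr1 big1 ?mulr1 // => j /negbTE ->.
      by rewrite expr0.
    by case: eqP.
  + exact: polynomial_cst.
- exists (Da + Db)%N, (fun w => Pa w * Qb w + Qa w * Pb w),
    (fun w => Qa w * Qb w); split.
  + by apply: polynomial_add; exact: polynomial_mul.
  + exact: polynomial_mul.
  + move=> w; have [Qa0 <-] := aE w; have [Qb0 <-] := bE w.
    by rewrite mulf_neq0 //; split=> //; rewrite mulrDl !mulrA [b w * _]mulrC.
- exists (Da + Db)%N, (fun w => Pa w * Pb w), (fun w => Qa w * Qb w); split.
  + exact: polynomial_mul.
  + exact: polynomial_mul.
  + move=> w; have [Qa0 <-] := aE w; have [Qb0 <-] := bE w.
    by rewrite mulf_neq0 // mulrACA.
- exists D, Q, P; split=> // w; have [Q0 <-] := aE w.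
  by rewrite mulf_neq0 // mulrA mulVf ?mul1r.
Qed.

End RationalFunctions.

Section AlgebraicRelation.
Variables (F : fieldType) (Omega : Type) (Gamma iota : finType).
Variables (g : Gamma -> Omega -> F) (x : iota -> Omega -> F).

(** Each numerator is multiplied by the denominators of the other functions. *)
Lemma common_denominator : (forall i, rational_in g (x i)) ->
  exists D P Q, [/\ forall i, polynomial_in g D (P i), polynomial_in g D Q
    & forall w, Q w != 0 /\ forall i, x i w * Q w = P i w].
Proof.
move=> rx.
have /choice[y yP] i : exists y : nat * (Omega -> F) * (Omega -> F),
    [/\ polynomial_in g y.1.1 y.1.2, polynomial_in g y.1.1 y.2
      & forall w, y.2 w != 0 /\ x i w * y.2 w = y.1.2 w].
  by have [D [P [Q ?]]] := rational_fraction (rx i); exists (D, P, Q).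
pose D := (\sum_i (y i).1.1)%N.
have leD i : ((y i).1.1 <= D)%N by rewrite /D (bigD1 i) //= leq_addr.
pose r i (j : iota) := if j == i then (y i).1.2 else (y j).2.
exists (#|iota| * D)%N, (fun i w => \prod_j r i j w), (fun w => \prod_j (y j).2 w).
split=> [i||w].
- apply: polynomial_prod => j; have [p1 p2 _] := yP j.
  by rewrite /r; case: eqP => [<-|_]; apply: polynomial_widen (leD j) _.
- apply: polynomial_prod => j; have [p1 p2 _] := yP j.
  exact: polynomial_widen (leD j) _.
- split=> [|i]; first by apply/prodf_neq0 => j _; case: (yP j) => _ _ /(_ w) [].
  rewrite (bigD1 i) //= [RHS](bigD1 i) //= /r eqxx mulrA.
  have [_ _ /(_ w) [_ ->]] := yP i; congr (_ * _).
  by apply: eq_bigr => j /negbTE ->.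
Qed.

(** Linear algebra stands in for transcendence degrees: after clearing
    denominators, the monomials of degree at most [D] in each [x i] lie in a
    space of dimension [O(D ^ #|Gamma|)], while there are
    [(D + 1) ^ #|iota|] of them. *)
Lemma algebraic_relation : (#|Gamma| < #|iota|)%N ->
  (forall i, rational_in g (x i)) ->
  exists D (c : {ffun iota -> 'I_D.+1} -> F), (exists e, c e != 0) /\
    forall w, \sum_e c e * \prod_i x i w ^+ e i = 0.
Proof.
move=> ltGi rx; have [k [P [Q [pP pQ xE]]]] := common_denominator rx.
pose M := (k * #|iota|)%N.
pose D := (M.+1 ^ #|Gamma|)%N.
(* The left-hand side is at most [((M + 1) (D + 1)) ^ #|Gamma|], and [D] is
   chosen to absorb the factor [(M + 1) ^ #|Gamma|] in one power of [D + 1]. *)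
have ltD : ((D * M).+1 ^ #|Gamma| < D.+1 ^ #|iota|)%N.
  apply: (@leq_ltn_trans (M.+1 ^ #|Gamma| * D.+1 ^ #|Gamma|)).
    have [->|G0] := posnP #|Gamma|; first by rewrite !expn0.
    by rewrite -expnMn leq_exp2r //; nia.
  apply: (@leq_trans (D.+1 ^ #|Gamma|.+1)); last by rewrite leq_pexp2l.
  by rewrite expnS ltn_pmul2r ?expn_gt0.
pose E := {ffun iota -> 'I_D.+1}; pose E' := {ffun Gamma -> 'I_(D * M).+1}.
have /choice[b bE] (e : E) : polynomial_in g (D * M)
    (fun w => (\prod_i x i w ^+ e i) * Q w ^+ (D * #|iota|)).
  have pe i : polynomial_in g (D * k) (fun w => P i w ^+ e i * Q w ^+ (D - e i)).
    rewrite -[X in (X * k)%N](subnKC (_ : e i <= D)%N) ?leq_ord // mulnDl.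
    by apply: polynomial_mul; exact: polynomial_exp.
  have := polynomial_prod pe; rewrite mulnCA (mulnC _ k) -/M.
  apply: polynomial_eq => w; have [_ {}xE] := xE w.
  rewrite exprM -prodr_const -big_split; apply: eq_bigr => i _ /=.
  by rewrite -xE exprMn -mulrA -exprD subnKC // -ltnS ltn_ord.
pose B : 'M[F]_(#|E|, #|E'|) := \matrix_(e, e') b (enum_val e) (enum_val e').
have : kermx B != 0.
  rewrite -mxrank_eq0 mxrank_ker subn_eq0 -ltnNge.
  apply: leq_ltn_trans (rank_leq_col _) _.
  by rewrite !card_ffun !card_ord; exact: leq_trans ltD _.
case/rowV0Pn => v /sub_kermxP vB v0.
exists D, (fun e => v 0 (enum_rank e)); split.
  have /rV0Pn[e ve] := v0; exists (enum_val e).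
  by rewrite enum_valK.
move=> w; have [Q0 _] := xE w.
apply: (mulIf (expf_neq0 (D * #|iota|) Q0)); rewrite mul0r mulr_suml.
under eq_bigr => e _ do rewrite -mulrA bE mulr_sumr.
rewrite exchange_big big1 //= => e' _.
under eq_bigr => e _ do rewrite mulrA.
rewrite -mulr_suml big_enum_val /=.
have /(congr1 (fun u : 'rV_ _ => u 0 (enum_rank e'))) := vB.
rewrite !mxE => vB'.
rewrite (_ : \sum_(i < #|E|) _ = 0) ?mul0r // -[RHS]vB'.
by apply: eq_bigr => i _; rewrite !mxE enum_valK enum_rankK.
Qed.
End AlgebraicRelation.

(** * Null sets of zeros of real polynomials *)

Section NullSets.
Local Open Scope classical_set_scope.
Variable R : realType.

Definition tuple_poly n D (c : n.-tuple 'I_D.+1 -> R)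
    (t : n.-tuple (measurableTypeR R)) : R :=
  \sum_e c e * \prod_i (tnth t i : R) ^+ tnth e i.

Lemma measurable_tuple_poly n D (c : n.-tuple 'I_D.+1 -> R) :
  measurable_fun setT (tuple_poly c : _ -> measurableTypeR R).
Proof.
apply: measurable_sum => e; apply: measurable_funM; first exact: measurable_cst.
apply: measurable_prod => i _; apply: measurable_funX.
exact: measurable_tnth.
Qed.

Lemma measurable_tuple_poly_zeros n D (c : n.-tuple 'I_D.+1 -> R) :
  measurable [set t | tuple_poly c t = 0].
Proof.
rewrite (_ : [set t | _] = setT `&` tuple_poly c @^-1` [set 0]).
  by apply: measurable_tuple_poly.
by rewrite setTI.
Qed.

Lemma tuple_poly_cons n D (c : n.+1.-tuple 'I_D.+1 -> R) (x : measurableTypeR R)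
    (t : n.-tuple (measurableTypeR R)) :
  tuple_poly c [tuple of x :: t] =
  tuple_poly (fun e : n.-tuple 'I_D.+1 => (\poly_(k < D.+1) c [tuple of inord k :: e]).[x]) t.
Proof.
rewrite /tuple_poly.
rewrite (reindex (fun p : 'I_D.+1 * n.-tuple 'I_D.+1 => [tuple of p.1 :: p.2])) /=; last first.
  exists (fun e => (thead e, [tuple of behead e])) => [[k e] _|e _] /=.
    by rewrite theadE; congr pair; exact: val_inj.
  by rewrite [RHS]tuple_eta.
rewrite -(pair_big xpredT xpredT
  (fun (k : 'I_D.+1) (e : n.-tuple 'I_D.+1) => c [tuple of k :: e] * \prod_i
     (tnth [tuple of x :: t] i : R) ^+ tnth [tuple of k :: e] i)) /= exchange_big /=.
apply: eq_bigr => e _; rewrite horner_poly mulr_suml.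
apply: eq_bigr => k _; rewrite big_ord_recl inord_val !tnth0 mulrA.
by congr (_ * _); apply: eq_bigr => i _; rewrite !tnthS.
Qed.

(** Seen as a polynomial in the last coordinates, [tuple_poly c] has for
    coefficients polynomials in the first coordinate, one of which is nonzero.
    Outside its finitely many roots, fixing the first coordinate leaves a nonzero
    polynomial in the others. *)
Lemma tuple_poly_zeros_null n D (c : n.-tuple 'I_D.+1 -> R) :
  (exists e, c e != 0) -> lebesgue_tuple n [set t | tuple_poly c t = 0] = 0%E.
Proof.
elim: n c => [|n IHn] c [e0 ce0].
  rewrite (_ : [set t | _] = set0) ?measure0 // -subset0 => t /= /eqP.
  rewrite /tuple_poly (big_pred1 e0) => [|e]; last by apply/esym/eqP; rewrite (tuple0 e) (tuple0 e0).
  by rewrite big_ord0 mulr1 (negbTE ce0).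
pose q (e : n.-tuple 'I_D.+1) : {poly R} := \poly_(k < D.+1) c [tuple of inord k :: e].
have q0 : q [tuple of behead e0] != 0.
  apply: contra_neq ce0 => /(congr1 (fun p : {poly R} => p`_(thead e0))).
  by rewrite coef_poly coef0 ltn_ord inord_val -tuple_eta.
rewrite /= /lebesgue_tuple_step /pushforward /product_measure1.
have mB : measurable [set xt : measurableTypeR R * n.-tuple (measurableTypeR R) |
    tuple_poly c [tuple of xt.1 :: xt.2] = 0].
  have mcons : measurable_fun setT (fun xt : measurableTypeR R *
      n.-tuple (measurableTypeR R) => [tuple of xt.1 :: xt.2]).
    exact: measurable_cons.
  have := mcons measurableT _ (measurable_tuple_poly_zeros c).
  by rewrite setTI.
pose N : set (measurableTypeR R) := [set x | root (q [tuple of behead e0]) x].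
have finN : finite_set N.
  apply: contrapT => /(@infinite_set_fset _ _ (size (q [tuple of behead e0])))[B BN].
  apply/negP; rewrite -ltnNge; apply: (max_poly_roots q0) (finmap.fset_uniq B).
  by apply/allP => x xB; exact: BN.
have mN : measurable N.
  by apply: countable_measurable => [x|]; [exact: measurable_set1|exact: finite_set_countable].
rewrite (@ge0_negligible_integral _ _ _ _ setT N) //; last 2 first.
- exact: measurable_fun_xsection.
- by apply: countable_lebesgue_measure0; exact: finite_set_countable.
apply: integral0_eq => x [_ /negP Nx].
rewrite /= (_ : xsection _ _ = [set t | tuple_poly (fun e => (q e).[x]) t = 0]).
  by apply: IHn; exists [tuple of behead e0].
by apply/seteqP; split=> t; rewrite /xsection /= inE /= tuple_poly_cons.
Qed.
End NullSets.

(** * Sets with fewer parameters than coordinates *)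

Section ThinSets.
Local Open Scope classical_set_scope.

(** The [x i] have a transcendence degree smaller than their number: they are
    rational functions of fewer parameters. *)
Definition algebraically_dependent (F : fieldType) (Omega : Type)
    (iota : finType) (x : iota -> Omega -> F) :=
  exists (Gamma : finType) (g : Gamma -> Omega -> F),
    (#|Gamma| < #|iota|)%N /\ forall i, rational_in g (x i).

Lemma rational_trans (F : fieldType) (Omega : Type) (Gamma Gamma' : finType)
    (g : Gamma -> Omega -> F) (g' : Gamma' -> Omega -> F) a :
  (forall i, rational_in g' (g i)) -> rational_in g a -> rational_in g' a.
Proof.
move=> gg'; elim=> [c|i|b c _ rb _ rc|b c _ rb _ rc|b b0 _ rb] //.
- exact: rational_cst.
- exact: rational_add.
- exact: rational_mul.
- exact: rational_inv.
Qed.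

(** The coordinates outside the subfamily serve as additional parameters. *)
Lemma dependent_subfamily (F : fieldType) (Omega : Type)
    (iota kappa : finType) (x : iota -> Omega -> F) (f : kappa -> iota) :
  injective f -> algebraically_dependent (fun k => x (f k)) ->
  algebraically_dependent x.
Proof.
move=> injf [Gamma [g [lt_Gk rg]]].
exists (Gamma + {i | i \notin codom f})%type,
  (fun s => match s with inl c => g c | inr i => x (val i) end).
split.
  rewrite card_sum card_sig -(cardC [in codom f]) card_codom //.
  by rewrite ltn_add2r.
move=> i; have [/codomP[k ->]|fi] := boolP (i \in codom f).
  by apply: rational_trans (rg k) => c; exact: (rational_gen _ (inl c)).
exact: (rational_gen _ (inr (exist _ i fi))).
Qed.

(** A substitute for the subsets of proper algebraic subvarieties, stable under
    finite unions by construction. *)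
Inductive thin (F : fieldType) n : set 'rV[F]_n -> Prop :=
| thin_image (Omega : Type) (x : 'I_n -> Omega -> F) :
    algebraically_dependent x -> thin [set \row_j x j w | w in [set: Omega]]
| thin_bigcup (T : finType) (B : T -> set 'rV[F]_n) :
    (forall c, thin (B c)) -> thin (\bigcup_c B c)
| thin_sub (B B' : set 'rV[F]_n) : B `<=` B' -> thin B' -> thin B.

Lemma thinU (F : fieldType) n (B B' : set 'rV[F]_n) :
  thin B -> thin B' -> thin (B `|` B').
Proof.
move=> tB tB'; have := @thin_bigcup F n bool (fun b => if b then B else B').
move=> /(_ (fun b => if b return thin (if b then B else B') then tB else tB')).
by apply: thin_sub => v [Bv|Bv]; [exists true|exists false].
Qed.

Lemma negligible_fin_bigcup d (T : measurableType d) (R : realType)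
    (mu : {measure set T -> \bar R}) (I : finType) (B : I -> set T) :
  (forall i, mu.-negligible (B i)) -> mu.-negligible (\bigcup_i B i).
Proof.
move=> nB; pose B' k := if unpickle k is Some i then B i else set0.
apply: (@negligibleS _ _ _ _ (\bigcup_k B' k)).
  by move=> v [i _ Bv]; exists (pickle i); rewrite // /B' pickleK.
apply: negligible_bigcup => k; rewrite /B'; case: unpickle => // .
exact: negligible_set0.
Qed.

Lemma dependent_null (R : realType) n (Omega : Type) (x : 'I_n -> Omega -> R) :
  algebraically_dependent x ->
  (lebesgue_tuple n).-negligible
    [set v : n.-tuple (measurableTypeR R) | exists w, forall j, tnth v j = x j w].
Proof.
move=> [Gamma [g [ltG /(algebraic_relation ltG)[D [c [[e0 ce0] cx]]]]]].
pose c' (e : n.-tuple 'I_D.+1) := c [ffun i => tnth e i].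
exists [set t | tuple_poly c' t = 0]; split.
- exact: measurable_tuple_poly_zeros.
- apply: tuple_poly_zeros_null; exists [tuple e0 j | j < n].
  rewrite /c' (_ : finfun _ = e0) //.
  by apply/ffunP => j; rewrite ffunE tnth_mktuple.
- move=> v [w vw]; rewrite /= -[RHS](cx w) /tuple_poly.
  rewrite (reindex (fun e : {ffun 'I_n -> 'I_D.+1} => [tuple e j | j < n])) /=; last first.
    exists (fun e => [ffun j => tnth e j]) => [e _|e _].
      by apply/ffunP => j; rewrite ffunE tnth_mktuple.
    by apply: eq_from_tnth => j; rewrite tnth_mktuple ffunE.
  apply: eq_bigr => e _; rewrite /c'; congr (c _ * _).
    by apply/ffunP => j; rewrite ffunE tnth_mktuple.
  by apply: eq_bigr => j _; rewrite tnth_mktuple vw.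
Qed.

Lemma thin_null_real (R : realType) n (B : set 'rV[R]_n) : thin B -> lebesgue_null_real B.
Proof.
elim=> [Om x dx|T B1 _ nB|B1 B2 BB _].
- apply: negligibleS (dependent_null dx) => v [w _ xv]; exists w => j.
  by move/rowP/(_ j): xv; rewrite !mxE.
- apply: negligibleS (negligible_fin_bigcup nB) => v [c _ Bv].
  by exists c.
- by apply: negligibleS => v; exact: BB.
Qed.

(** The inverse of [z] is its conjugate divided by [Re z ^+ 2 + Im z ^+ 2], which
    is rational in the real and imaginary parts. *)
Lemma rational_ReIm (R : realType) (Omega : Type) (Gamma : finType) (g : Gamma -> Omega -> R[i]) a :
  rational_in g a ->
  let g' (s : Gamma + Gamma) w :=
    match s with inl c => complex.Re (g c w) | inr c => complex.Im (g c w) end in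
  rational_in g' (fun w => complex.Re (a w)) /\ rational_in g' (fun w => complex.Im (a w)).
Proof.
move=> ra g'; elim: ra => [c|i|b c _ [rb ib] _ [rc ic]|b c _ [rb ib] _ [rc ic]|b b0 _ [rb ib]].
- by split; exact: rational_cst.
- by split; [exact: (rational_gen g' (inl i))|exact: (rational_gen g' (inr i))].
- split.
    by apply: rational_eq (rational_add rb rc) => w; move: (b w) (c w) => [? ?] [? ?].
  by apply: rational_eq (rational_add ib ic) => w /=; case: (b w); case: (c w).
- split.
    apply: rational_eq (rational_add (rational_mul rb rc)
      (rational_opp (rational_mul ib ic))) => w.
    by move: (b w) (c w) => [? ?] [? ?].
  apply: rational_eq (rational_add (rational_mul rb ic)
    (rational_mul ib rc)) => w.
  by move: (b w) (c w) => [? ?] [? ?].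
- pose N w := complex.Re (b w) * complex.Re (b w) + complex.Im (b w) * complex.Im (b w).
  have N0 w : N w != 0.
    have := b0 w; rewrite /N eq_complex /=.
    by apply: contraNneq => /eqP; rewrite paddr_eq0 ?sqr_ge0 -?expr2 ?sqr_ge0 // !sqrf_eq0.
  have rN : rational_in g' (fun w => (N w)^-1).
    by apply: rational_inv => //; apply: rational_add; exact: rational_mul.
  split.
    apply: rational_eq (rational_mul rb rN) => w.
    by rewrite /N; case: (b w) => x y /=; rewrite !expr2.
  apply: rational_eq (rational_mul (rational_opp ib) rN) => w.
  by rewrite /N; case: (b w) => x y /=; rewrite !expr2 mulNr.
Qed.

Lemma thin_null_complex (R : realType) n (B : set 'rV[R[i]]_n) : thin B -> lebesgue_null_complex B.
Proof.
elim=> [Om x [Gamma [g [ltG rx]]]|T B1 _ nB|B1 B2 BB _].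
- pose y (j : 'I_(n + n)) w :=
    match fintype.split j with inl k => complex.Re (x k w) | inr k => complex.Im (x k w) end.
  have dy : algebraically_dependent y.
    exists (Gamma + Gamma)%type, (fun s w =>
      match s with inl c => complex.Re (g c w) | inr c => complex.Im (g c w) end); split.
      by move: ltG; rewrite card_sum !card_ord; lia.
    by move=> j; rewrite /y; case: (fintype.split j) => k; have [] := rational_ReIm (rx k).
  apply: negligibleS (dependent_null dy) => v [w _ xv]; exists w => j.
  rewrite /y; case: fintype.splitP => k jk; move/rowP/(_ k): xv; rewrite !mxE => ->;
  by congr (tnth v _); exact: val_inj.
- apply: negligibleS (negligible_fin_bigcup nB) => v [c _ Bv].
  by exists c.
- by apply: negligibleS => v; exact: BB.
Qed.

End ThinSets.

(** * Uniqueness from the two properties of the factors *)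

(** The type [{set 'I_n}] is elaborated with a reverse coercion around ['I_n],
    which prevents [lia] from identifying equal cardinals. *)
Ltac card_lia := unfold reverse_coercion in *; lia.

Lemma exists_superset (T : finType) (S : {set T}) t :
  (#|S| <= t <= #|T|)%N -> exists S' : {set T}, S \subset S' /\ #|S'| = t.
Proof.
move=> /andP[]; elim: t => [|t IHt]; first by rewrite leqn0 => /eqP S0 _; exists S.
rewrite leq_eqVlt => /predU1P[<- _|]; first by exists S.
rewrite ltnS => St tT; have [S' [SS' S't]] := IHt St (ltnW tT).
have /card_gt0P[x xS'] : (0 < #|~: S'|)%N by have := cardsC S'; lia.
exists (x |: S'); split; first exact: fintype.subset_trans SS' (finset.subsetU1 _ _).
by move: xS'; rewrite inE cardsU1 S't => ->.
Qed.

Section Gram.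
Variable F : fieldType.

Definition weight n (lam : 'rV[F]_n) := #|[set r | lam 0 r != 0]|.

Definition gram m n (A : 'M[F]_(m, n)) (lam : 'rV[F]_n) : 'M[F]_m :=
  A *m diag_mx lam *m A^T.

Lemma gramE m n (A : 'M[F]_(m, n)) lam i j :
  gram A lam i j = \sum_r A i r * lam 0 r * A j r.
Proof. by rewrite /gram mxE; apply: eq_bigr => r _; rewrite mul_mx_diag !mxE. Qed.

Lemma gramD m n (A : 'M[F]_(m, n)) lam mu : gram A (lam + mu) = gram A lam + gram A mu.
Proof. by rewrite /gram raddfD /= mulmxDr mulmxDl. Qed.

Lemma rank_diag_le n (lam : 'rV[F]_n) : (\rank (diag_mx lam) <= weight lam)%N.
Proof.
rewrite diag_mx_sum_delta /weight (bigID (fun r => lam 0 r != 0)) /=.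
rewrite [X in _ + X]big1 ?addr0 => [|r /negPn/eqP ->]; last by rewrite scale0r.
rewrite -sum1dep_card; elim/big_ind2: _ => [|M1 n1 M2 n2 h1 h2|r _].
- by rewrite mxrank0.
- exact: leq_trans (mxrank_add _ _) (leq_add h1 h2).
- by rewrite (leq_trans (mxrank_scale _ _)) // mxrank_delta.
Qed.

Lemma rank_gram_le m n (A : 'M[F]_(m, n)) lam : (\rank (gram A lam) <= weight lam)%N.
Proof.
apply: leq_trans (mxrankM_maxl _ _) _.
exact: leq_trans (mxrankM_maxr _ _) (rank_diag_le _).
Qed.

Definition indicator n (S : {set 'I_n}) : 'rV[F]_n := \row_r (r \in S)%:R.

Lemma weight_indicator n (S : {set 'I_n}) : weight (indicator S) = #|S|.
Proof.
rewrite /weight; congr #|pred_of_set _|; apply/setP => r; rewrite !inE mxE.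
by case: (r \in S); rewrite ?oner_eq0 ?eqxx.
Qed.

(** Each added term [a_r a_r^T] raises the weight by one and the rank by at most
    one. *)
Lemma gram_extend m n (A : 'M[F]_(m, n)) lam t : (weight lam <= t <= n)%N ->
  exists mu, weight mu = t /\ (\rank (gram A mu) <= \rank (gram A lam) + (t - weight lam))%N.
Proof.
move=> t_bnd; pose S := [set r | lam 0 r != 0].
have [|S' [SS' S't]] := @exists_superset _ S t; first by rewrite card_ord.
exists (lam + indicator (S' :\: S)); split.
  rewrite -S't /weight; congr #|pred_of_set _|; apply/setP => r.
  rewrite !inE !mxE !inE; case: (eqVneq (lam 0 r) 0) => [->|lr] /=.
    by rewrite add0r; case: (r \in S'); rewrite ?oner_eq0 ?eqxx.
  by rewrite addr0 lr; symmetry; apply: (fintype.subsetP SS'); rewrite inE.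
rewrite gramD; apply: leq_trans (mxrank_add _ _) _; rewrite leq_add2l.
apply: leq_trans (rank_gram_le _ _) _.
by rewrite weight_indicator cardsDS // S't.
Qed.

(** In geometric terms: the linear span of the points [a_r a_r^T] of the
    Veronese variety meets its [q]-th secant variety only in the spans of [q]
    of these points. *)
Definition no_low_rank m n (A : 'M[F]_(m, n)) q :=
  forall lam : 'rV[F]_n, (\rank (gram A lam) <= q)%N -> (weight lam <= q)%N.

(** If the rank were smaller than the weight, adding terms up to weight [q + 1]
    would give a matrix of rank at most [q]. *)
Lemma weight_le_rank_gram m n (A : 'M[F]_(m, n)) q lam : (q < n)%N ->
  no_low_rank A q -> (weight lam <= q)%N -> (weight lam <= \rank (gram A lam))%N.
Proof.
move=> qn gA lq; have [|mu [wmu rmu]] := @gram_extend _ _ A lam q.+1.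
  by rewrite qn andbT leqW.
rewrite leqNgt; apply/negP => rk; suff: (weight mu <= q)%N by lia.
by apply: gA; lia.
Qed.

(** A relation between at most [q + 1] columns of [A] bounds by [q] the rank of
    the sum of [a_r a_r^T] over [q + 1] indices that contain its support. *)
Lemma no_low_rank_free m n (A : 'M[F]_(m, n)) q (v : 'cV[F]_n) (S : {set 'I_n}) :
  (q < n)%N -> no_low_rank A q -> A *m v = 0 ->
  (forall r, r \notin S -> v r 0 = 0) -> (#|S| <= q.+1)%N -> v = 0.
Proof.
move=> qn gA Av vS Sq; apply/eqP/contraT => /cV0Pn[r0 vr0].
have [|S' [SS' S'q]] := @exists_superset _ S q.+1; first by rewrite card_ord Sq.
suff: (weight (indicator S') <= q)%N by rewrite weight_indicator S'q ltnn.
apply: gA.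
have vS' r : r \notin S' -> v r 0 = 0.
  by move=> rS'; apply: vS; apply: contra rS'; exact: (fintype.subsetP SS').
have r0S' : r0 \in S' by apply: contraNT vr0 => /vS' ->.
(* [M] is the identity except that its column [r0] rewrites [a_r0] in terms of
   the other columns, so that [A *m M = A]. *)
pose M : 'M[F]_n := 1%:M - (v r0 0)^-1 *: (v *m delta_mx 0 r0).
have AM : A *m M = A by rewrite mulmxBr mulmx1 -scalemxAr mulmxA Av mul0mx scaler0 subr0.
have MD : M *m diag_mx (indicator S') =
    diag_mx (indicator (S' :\ r0)) *m (M *m diag_mx (indicator S')).
  apply/matrixP => i j; rewrite mul_diag_mx [RHS]mxE mul_mx_diag !mxE !inE.
  rewrite big_ord_recl big_ord0 addr0 !mxE /=.
  have [->|ir0] := eqVneq i r0.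
    have [->|_] := eqVneq j r0; first by rewrite /= mulr1 mulVf // subrr !mul0r.
    by rewrite /= !mulr0 subr0 !mul0r.
  have [iS'|niS'] := boolP (i \in S'); first by rewrite mul1r.
  rewrite (vS' i niS') mul0r mulr0 subr0 [RHS]mul0r.
  by have [<-|_] := eqVneq i j; rewrite ?(negbTE niS') ?mulr0 ?mul0r.
rewrite /gram -{1}AM -(mulmxA A) MD !mulmxA -2!mulmxA.
apply: leq_trans (mxrankM_maxl _ _) _.
apply: leq_trans (mxrankM_maxr _ _) _.
apply: leq_trans (rank_diag_le _) _; rewrite weight_indicator.
by move/eqP: S'q; rewrite (cardsD1 r0) r0S' add1n eqSS => /eqP ->.
Qed.

Definition killed K n (C : 'M[F]_(K, n)) (x : 'rV[F]_K) := [set r | (x *m C) 0 r == 0].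

Lemma weight_killed K n (C : 'M[F]_(K, n)) x : (weight (x *m C) + #|killed C x| = n)%N.
Proof.
rewrite -[RHS](card_ord n) -(cardsC (killed C x)) addnC; congr (_ + #|pred_of_set _|)%N.
by apply/setP => r; rewrite !inE.
Qed.

Lemma mulmx_colE K n (C : 'M[F]_(K, n)) (x : 'rV[F]_K) r :
  (x *m C) 0 r = (x *m col r C) 0 0.
Proof. by rewrite !mxE; apply: eq_bigr => k _; rewrite mxE. Qed.

Lemma mulmx_sub_scale K n (C : 'M[F]_(K, n)) (x y : 'rV[F]_K) c r :
  ((y - c *: x) *m C) 0 r = (y *m C) 0 r - c * (x *m C) 0 r.
Proof. by rewrite mulmxBl -scalemxAl; move: (y *m C) (x *m C) => u v; rewrite !mxE. Qed.

Lemma exists_killing K n n' (C : 'M[F]_(K, n)) (C' : 'M[F]_(K, n'))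
    (S : {set 'I_n}) (S' : {set 'I_n'}) : (#|S| + #|S'| < K)%N ->
  exists x : 'rV[F]_K, [/\ x != 0, S \subset killed C x & S' \subset killed C' x].
Proof.
move=> lt_K.
pose M := row_mx (C *m diag_mx (indicator S)) (C' *m diag_mx (indicator S')).
have rM : (\rank M < K)%N.
  apply: leq_ltn_trans lt_K; rewrite -(weight_indicator S) -(weight_indicator S').
  have -> : M = C *m diag_mx (indicator S) *m row_mx 1%:M 0
              + C' *m diag_mx (indicator S') *m row_mx 0 1%:M.
    by rewrite !mul_mx_row !mulmx1 !mulmx0 add_row_mx addr0 add0r.
  apply: leq_trans (mxrank_add _ _) _.
  by apply: leq_add; apply: leq_trans (mxrankM_maxl _ _) _;
     apply: leq_trans (mxrankM_maxr _ _) (rank_diag_le _).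
have /rowV0Pn[x /sub_kermxP xM x0] : kermx M != 0.
  by rewrite -mxrank_eq0 mxrank_ker subn_eq0 -ltnNge.
move: xM; rewrite /M mul_mx_row -[0]row_mx0 => /eq_row_mx[xC xC'].
exists x; split=> //; apply/fintype.subsetP => r rS; rewrite inE.
  by move/rowP/(_ r): xC; rewrite mulmxA mul_mx_diag !mxE rS mulr1 => ->.
by move/rowP/(_ r): xC'; rewrite mulmxA mul_mx_diag !mxE rS mulr1 => ->.
Qed.

Lemma col_neq0 K n (C : 'M[F]_(K, n)) r : (0 < K)%N -> (K <= n)%N ->
  (forall x : 'rV[F]_K, x != 0 -> (#|killed C x| < K)%N) -> col r C != 0.
Proof.
move=> K_gt0 leKn C_free.
apply/eqP => Cr; have [|S [rS SK]] := @exists_superset _ [set r] K.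
  by rewrite cards1 card_ord leKn K_gt0.
have [|x [x0 Sx _]] := @exists_killing _ _ _ C C (S :\ r) finset.set0.
  by rewrite cards0 addn0 -SK [leqRHS](cardsD1 r) (fintype.subsetP rS) ?inE.
have /subset_leq_card : S \subset killed C x.
  apply/fintype.subsetP => k kS; have [->|kr] := eqVneq k r.
    by rewrite inE mulmx_colE Cr mulmx0 mxE.
  by apply: (fintype.subsetP Sx); rewrite !inE kr.
by have := C_free x x0; rewrite SK; card_lia.
Qed.
End Gram.

Section Permutation.
Variables (F : fieldType) (K R : nat) (C C' : 'M[F]_(K, R)).
Hypotheses (K_gt1 : (1 < K)%N) (leKR : (K <= R)%N).
Hypothesis C_free : forall x : 'rV[F]_K, x != 0 -> (#|killed C x| < K)%N.
Hypothesis C'_free : forall x : 'rV[F]_K, x != 0 -> (#|killed C' x| < K)%N.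
Hypothesis hyperplanes : forall x : 'rV[F]_K, x != 0 ->
  (K.-1 <= #|killed C' x|)%N -> #|killed C x| = K.-1.

(** The columns of [C] in the span of the columns of [C'] indexed by [S], the
    span being described by the linear forms that vanish on it. *)
Definition closure_in (S : {set 'I_R}) : {set 'I_R} :=
  [set r | `[< forall x : 'rV[F]_K, S \subset killed C' x -> r \in killed C x >]].

Lemma closure_inS (S S' : {set 'I_R}) : S \subset S' -> closure_in S \subset closure_in S'.
Proof.
move=> SS'; apply/fintype.subsetP => r; rewrite !inE => /asboolP rS; apply/asboolP => x S'x.
exact/rS/(fintype.subset_trans SS').
Qed.

(** Up to a scalar, only one linear form vanishes on [K - 1] columns of [C']. *)
Lemma closure_in_hyperplane (S : {set 'I_R}) : #|S| = K.-1 -> #|closure_in S| = K.-1.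
Proof.
move=> SK; have [|x [x0 _ Sx]] := @exists_killing _ _ _ _ C C' finset.set0 S.
  by rewrite cards0 SK add0n prednK // ltnW.
have {}Sx : S = killed C' x.
  by apply/eqP; rewrite eqEcard Sx SK; rewrite /= -ltnS prednK ?C'_free // ltnW.
rewrite -(hyperplanes x0) -?Sx ?SK //; congr #|pred_of_set _|; apply/setP => r.
rewrite inE; apply/asboolP/idP => [|xr y Sy]; first by apply; rewrite Sx.
have /card_gt0P[j jS] : (0 < #|~: S|)%N by have := cardsC S; rewrite card_ord; card_lia.
have xj : (x *m C') 0 j != 0 by move: jS; rewrite Sx !inE.
pose z := y - ((y *m C') 0 j / (x *m C') 0 j) *: x.
have [z0|/C'_free] := eqVneq z 0.
  have := mulmx_sub_scale C x y ((y *m C') 0 j / (x *m C') 0 j) r.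
  by rewrite -/z z0 mul0mx mxE; move: xr; rewrite !inE => /eqP -> /esym; rewrite mulr0 subr0 => ->.
rewrite ltnNge => /negP[]; have : j |: S \subset killed C' z.
  apply/fintype.subsetP => k; rewrite !inE mulmx_sub_scale => /predU1P[->|kS].
    by rewrite divfK ?subrr.
  have := kS; rewrite {1}Sx inE => /eqP ->; rewrite mulr0 subr0.
  by have := fintype.subsetP Sy _ kS; rewrite inE.
by move/subset_leq_card; rewrite cardsU1; move: jS; rewrite inE => ->; card_lia.
Qed.

(** Through a flat spanned by [k] columns of [C'] pass [R - k] flats spanned by
    [k + 1] columns, and they share nothing else.  If each of them contains
    [k + 1] columns of [C], the smaller flat must contain [k]: otherwise these
    [R - k] flats would need more columns of [C] than there are. *)
Lemma card_closure_in (S : {set 'I_R}) : (0 < #|S| < K)%N -> #|closure_in S| = #|S|.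
Proof.
have [N ltSN] := ubnP (K - #|S|); elim: N S ltSN => // N IHN S ltSi /andP[S_gt0 SK].
have [SK1|ltSK] := eqVneq #|S|.+1 K; first by rewrite closure_in_hyperplane -SK1.
have SK2 : (#|S|.+2 <= K)%N by card_lia.
have cardU j : j \notin S -> #|closure_in (j |: S)| = #|S|.+1.
  by move=> jS; rewrite IHN ?cardsU1 ?jS //; card_lia.
have leS : (#|closure_in S| <= #|S|)%N.
  rewrite leqNgt; apply/negP => ltS.
  have [|S1 [clS1 S1K]] := @exists_superset _ (closure_in S) (maxn #|closure_in S| K).
    by have := max_card (closure_in S); rewrite card_ord; card_lia.
  have [|x [x0 S1x Sx]] := @exists_killing _ _ _ _ C C' (S1 :\: closure_in S) S.
    by rewrite cardsDS // S1K; card_lia.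
  (* [x] kills all of [closure_in S], as it kills the columns [S] of [C']. *)
  have /subset_leq_card : S1 \subset killed C x.
    apply/fintype.subsetP => r rS1; have [rS|rS] := boolP (r \in closure_in S).
      by move: rS; rewrite inE => /asboolP; apply.
    by apply: (fintype.subsetP S1x); rewrite inE rS.
  by have := C_free x0; rewrite S1K; card_lia.
have disj j j' : j \notin S -> j' \notin S -> j != j' ->
    closure_in (j |: S) :&: closure_in (j' |: S) \subset closure_in S.
  move=> jS j'S jj'; apply/fintype.subsetP => r; rewrite !inE.
  case/andP=> /asboolP rj /asboolP rj'; apply/asboolP => x Sx.
  have [|S1 [jS1 S1K]] := @exists_superset _ (j' |: (j |: S)) K.
    by rewrite !cardsU1 !inE negb_or j'S jS eq_sym jj' card_ord leKR; card_lia.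
  have [|y [y0 _ S1y]] := @exists_killing _ _ _ _ C C' finset.set0 (S1 :\ j').
    rewrite cards0 -S1K [leqRHS](cardsD1 j') (fintype.subsetP jS1) ?add0n //.
    by rewrite !inE eqxx.
  have yj' : (y *m C') 0 j' != 0.
    apply/eqP => yj'; have /subset_leq_card : S1 \subset killed C' y.
      apply/fintype.subsetP => k kS1; have [->|kj'] := eqVneq k j'.
        by rewrite inE yj'.
      by apply: (fintype.subsetP S1y); rewrite !inE kj'.
    by have := C'_free y0; rewrite S1K; card_lia.
  have jSy : j |: S \subset killed C' y.
    apply/fintype.subsetP => k kS; apply: (fintype.subsetP S1y); rewrite !inE.
    rewrite (fintype.subsetP jS1) ?andbT; last by rewrite inE kS orbT.
    by apply: contraTneq kS => ->; rewrite !inE eq_sym (negbTE jj').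
  have := rj y jSy; rewrite !inE => /eqP yr.
  have /rj' : j' |: S \subset killed C' (x - ((x *m C') 0 j' / (y *m C') 0 j') *: y).
    apply/fintype.subsetP => k; rewrite !inE mulmx_sub_scale => /predU1P[->|kS].
      by rewrite divfK ?subrr.
    have := fintype.subsetP jSy k; rewrite !inE kS orbT => /(_ isT)/eqP ->.
    by have := fintype.subsetP Sx k kS; rewrite inE mulr0 subr0.
  by rewrite !inE mulmx_sub_scale yr mulr0 subr0.
pose X j := closure_in (j |: S) :\: closure_in S.
have cardX j : j \notin S -> #|X j| = (#|S|.+1 - #|closure_in S|)%N.
  by move=> jS; rewrite cardsDS ?cardU ?closure_inS // finset.subsetU1.
have : (\sum_(j in ~: S) #|X j| <= #|~: closure_in S|)%N.
  under eq_bigr => j _ do rewrite -sum1_card.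
  rewrite (exchange_big_dep (mem (~: closure_in S))) /=; last first.
    by move=> j r _; rewrite !inE => /andP[].
  rewrite -sum1_card; apply: leq_sum => r _.
  rewrite sum1dep_card; apply/card_le1_eqP => j j'; rewrite !inE.
  case/andP=> jS /andP[rS rj] /andP[j'S /andP[_ rj']].
  apply/eqP/contraT => jj'; have := fintype.subsetP (disj _ _ j'S jS jj') r.
  by rewrite !inE rj rj' (negbTE rS) => /(_ isT).
rewrite (eq_bigr (fun=> #|S|.+1 - #|closure_in S|)%N); last first.
  by move=> j; rewrite inE; exact: cardX.
rewrite sum_nat_const.
have := cardsC S; have := cardsC (closure_in S); rewrite card_ord.
unfold reverse_coercion in *; nia.
Qed.

(** Kruskal's permutation lemma: each line spanned by a column of [C'] contains
    exactly one column of [C], by [card_closure_in] for singletons. *)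
Lemma columns_proportional : exists (s : {perm 'I_R}) (d : 'I_R -> F),
  forall j, d j != 0 /\ col (s j) C = d j *: col j C'.
Proof.
have free_off j j' : j != j' -> exists x, j \in killed C' x /\ j' \notin killed C' x.
  move=> jj'; have [|S [jS SK]] := @exists_superset _ (j' |: [set j]) K.
    by rewrite cardsU1 cards1 !inE eq_sym jj' card_ord leKR andbT.
  have j'S : j' \in S by apply: (fintype.subsetP jS); rewrite !inE eqxx.
  have [|x [x0 _ Sx]] := @exists_killing _ _ _ _ C C' finset.set0 (S :\ j').
    by rewrite cards0 -SK [leqRHS](cardsD1 j') j'S.
  exists x; split.
    apply: (fintype.subsetP Sx); rewrite !inE jj' /=.
    by apply: (fintype.subsetP jS); rewrite !inE eqxx orbT.
  apply/negP => xj'; have /subset_leq_card : S \subset killed C' x.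
    apply/fintype.subsetP => k kS; have [->//|kj'] := eqVneq k j'.
    by apply: (fintype.subsetP Sx); rewrite !inE kj'.
  by have := C'_free x0; rewrite SK; card_lia.
have colC r : col r C != 0 by exact: col_neq0 (ltnW K_gt1) leKR C_free.
have /choice[s sP] j : exists r, closure_in [set j] = [set r].
  have /eqP/cards1P[r ->] : #|closure_in [set j]| = 1%N; last by exists r.
  by rewrite card_closure_in cards1 // K_gt1.
have /choice[d dP] j : exists c, col (s j) C = c *: col j C'.
  suff /sub_rVP[c cP] : ((col (s j) C)^T <= (col j C')^T)%MS.
    by exists c; apply: trmx_inj; rewrite cP linearZ.
  rewrite submxE; apply/eqP/matrixP => i k; rewrite [RHS]mxE.
  set N := cokermx _; pose x : 'rV[F]_K := (col k N)^T.
  have xN n (D : 'M[F]_(K, n)) r : (x *m D) 0 r = ((col r D)^T *m N) 0 k.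
    by rewrite !mxE; apply: eq_bigr => l _; rewrite !mxE mulrC.
  have : s j \in closure_in [set j] by rewrite sP inE.
  rewrite inE => /asboolP/(_ x); rewrite finset.sub1set !inE !xN ord1.
  by rewrite mulmx_coker mxE eqxx => /(_ isT)/eqP.
have d0 j : d j != 0 by apply: contraNneq (colC (s j)) => dj; rewrite dP dj scale0r.
have s_inj : injective s.
  move=> j j' sjj'; apply/eqP/contraT => /free_off[x []].
  have xd k : (x *m C) 0 (s k) = d k * (x *m C') 0 k.
    by rewrite mulmx_colE dP -scalemxAr mxE -mulmx_colE.
  rewrite !inE => /eqP xj /negP[]; have := xd j'; rewrite -sjj' xd xj mulr0 => /esym/eqP.
  by rewrite mulf_eq0 (negbTE (d0 j')).
exists (perm s_inj), d => j; rewrite permE; split; [exact: d0|exact: dP].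
Qed.
End Permutation.

Section Uniqueness.
Variables (F : fieldType) (I K R q : nat).
Hypotheses (K_gt1 : (1 < K)%N) (leKR : (K <= R)%N) (qE : (q + K = R.+1)%N).

Lemma no_low_rank_perm (A : 'M[F]_(I, R)) (s : {perm 'I_R}) :
  no_low_rank A q -> no_low_rank (col_perm s A) q.
Proof.
move=> gA lam; pose mu : 'rV[F]_R := \row_r lam 0 ((s^-1)%g r).
have -> : gram (col_perm s A) lam = gram A mu.
  apply/matrixP => i j; rewrite !gramE [RHS](reindex_inj (@perm_inj _ s)).
  by apply: eq_bigr => r _; rewrite !mxE permK.
move=> /gA; rewrite /weight -[#|[set r | lam 0 r != 0]|](card_imset _ (@perm_inj _ s)).
congr (_ <= _)%N; congr #|pred_of_set _|; apply/setP => r; rewrite inE mxE.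
apply/idP/imsetP => [lr|[k]]; last by rewrite inE => lk ->; rewrite permK.
by exists ((s^-1)%g r); rewrite ?inE ?permKV.
Qed.

(** For every set [Q] of [q] indices some [x C] has support [Q].  The matrix
    [gram A' (x C)] has rank [q] and is a combination of [q] products
    [a'_j a'_j^T], so these [a'_j] lie in its column space, which is spanned by
    the [a_r] with [r] in [Q].  Letting [Q] vary among the subsets of a set of
    [q + 1] indices, whose columns [a_r] are independent, leaves for [a'_j] the
    line of [a_j] only. *)
Lemma factors_proportional (A A' : 'M[F]_(I, R)) (C : 'M[F]_(K, R)) (d : 'rV[F]_R) :
  no_low_rank A q -> (forall x : 'rV[F]_K, x != 0 -> (#|killed C x| < K)%N) ->
  (forall j, d 0 j != 0) ->
  (forall x : 'rV[F]_K, gram A (\row_j ((x *m C) 0 j * d 0 j)) = gram A' (x *m C)) ->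
  forall j, exists e, col j A' = e *: col j A /\ d 0 j = e ^+ 2.
Proof.
move=> gA C_free d0 gAA'; have q_gt0 : (0 < q)%N by lia.
have ltqR : (q < R)%N by lia.
have exS (Q : {set 'I_R}) : #|Q| = q -> exists x : 'rV[F]_K, killed C x = ~: Q.
  move=> Qq; have cQ : #|~: Q| = K.-1 by have := cardsC Q; rewrite card_ord; card_lia.
  have [|x [x0 _ Qx]] := @exists_killing _ _ _ _ C C finset.set0 (~: Q).
    by rewrite cards0 cQ; lia.
  exists x; apply/eqP; rewrite eq_sym eqEcard Qx cQ.
  by have := C_free x x0; card_lia.
have span (Q : {set 'I_R}) j : #|Q| = q -> j \in Q ->
    exists2 v : 'cV[F]_R, A *m v = col j A' & forall r, r \notin Q -> v r 0 = 0.
  move=> Qq jQ; have [x xQ] := exS Q Qq.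
  pose mu := x *m C; pose lam : 'rV[F]_R := \row_j (mu 0 j * d 0 j).
  have muQ r : (mu 0 r != 0) = (r \in Q).
    by have := congr1 (fun S : {set _} => r \in S) xQ; rewrite !inE => ->; rewrite negbK.
  have lamQ r : (lam 0 r != 0) = (r \in Q) by rewrite /lam mxE mulf_eq0 (negbTE (d0 r)) orbF muQ.
  have wmu : weight mu = q by rewrite -Qq; congr #|pred_of_set _|; apply/setP => r; rewrite inE muQ.
  have wlam : weight lam = q by rewrite -Qq; congr #|pred_of_set _|; apply/setP => r; rewrite inE lamQ.
  (* Equality of ranks turns the inclusion [sub] of row spaces around. *)
  pose M := diag_mx mu *m A'^T.
  have sub : (gram A lam <= M)%MS by rewrite gAA' /gram -mulmxA submxMl.
  have : (M <= gram A lam)%MS.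
    rewrite -(mxrank_leqif_sup sub); apply/eqP/anti_leq.
    rewrite mxrankS //=; apply: leq_trans (mxrankM_maxl _ _) _.
    apply: leq_trans (rank_diag_le _) _; rewrite wmu -{1}wlam.
    by apply: weight_le_rank_gram ltqR gA _; rewrite wlam.
  have subA : (gram A lam <= diag_mx lam *m A^T)%MS by rewrite /gram -mulmxA submxMl.
  move=> /submx_trans/(_ subA) => /submxP[E ME].
  clearbody lam.
  pose v := ((mu 0 j)^-1 *: row j (E *m diag_mx lam))^T.
  exists v => [|r].
    apply: trmx_inj; rewrite trmx_mul trmxK -scalemxAl -row_mul -mulmxA -ME.
    rewrite row_mul row_diag_mx -scalemxAl scalerA mulVf ?muQ // scale1r -rowE.
    by rewrite tr_col.
  move=> rQ; have := lamQ r; rewrite (negbTE rQ) => /negbFE/eqP lr.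
  by rewrite mxE mxE [row _ _ _ _]mxE mul_mx_diag [X in _ * X]mxE lr !mulr0.
have /choice[e eP] j : exists e, col j A' = e *: col j A.
  have [|P [jP Pq]] := @exists_superset _ [set j] q.+1.
    by rewrite cards1 card_ord ltqR.
  have {}jP : j \in P by apply: (fintype.subsetP jP); rewrite inE.
  have spanP k : k \in P -> k != j -> exists2 v : 'cV[F]_R, A *m v = col j A' &
      forall r, r \notin P :\ k -> v r 0 = 0.
    move=> kP kj; apply: span; last by rewrite !inE eq_sym kj.
    by move/eqP: Pq; rewrite (cardsD1 k) kP add1n eqSS => /eqP.
  have /card_gt0P[k] : (0 < #|P :\ j|)%N.
    by move/eqP: Pq; rewrite (cardsD1 j) jP add1n eqSS => /eqP ->.
  rewrite !inE => /andP[kj kP].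
  have [v Av vP] := spanP k kP kj.
  have vj r : r != j -> v r 0 = 0.
    move=> rj; have [rP|rP] := boolP (r \in P); last by apply: vP; rewrite inE negb_and rP orbT.
    have [v' Av' v'P] := spanP r rP rj.
    suff /eqP : v - v' = 0.
      by rewrite subr_eq0 => /eqP ->; apply: v'P; rewrite !inE eqxx.
    apply: (no_low_rank_free ltqR gA (S := P)); rewrite ?Pq //.
      by rewrite mulmxBr Av Av' subrr.
    by move=> l lP; rewrite !mxE vP ?v'P ?subrr // !inE negb_and lP orbT.
  exists (v j 0); rewrite -Av; apply/colP => i; rewrite !mxE (bigD1 j) //= big1 ?addr0.
    by rewrite mulrC.
  by move=> r rj; rewrite vj // mulr0.
move=> j; exists (e j); split; first exact: eP.
have [|Q [jQ Qq]] := @exists_superset _ [set j] q.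
  by rewrite cards1 card_ord q_gt0 ltnW.
have [x xQ] := exS Q Qq.
pose mu := x *m C; pose lam : 'rV[F]_R := \row_r (mu 0 r * (d 0 r - e r ^+ 2)).
have wlam : (weight lam <= q)%N.
  rewrite -Qq; apply/subset_leq_card/fintype.subsetP => r; rewrite inE /lam mxE mulf_eq0 negb_or.
  case/andP=> mur _; have := congr1 (fun S : {set _} => r \in S) xQ.
  by rewrite !inE (negbTE mur) => /esym/negbFE.
(* Replacing [a'_r] by [e_r a_r] on the right leaves a vanishing combination of
   at most [q] terms. *)
have g0 : gram A lam = 0.
  have := gAA' x; rewrite -/mu => /matrixP gx; apply/matrixP => i k.
  rewrite [RHS]mxE gramE; have := gx i k; rewrite !gramE => /eqP; rewrite -subr_eq0 => /eqP h.
  rewrite -[RHS]h -sumrB; apply: eq_bigr => r _.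
  have A'E l : A' l r = e r * A l r by have /colP/(_ l) := eP r; rewrite !mxE.
  by rewrite !A'E /lam !mxE; ring.
have := weight_le_rank_gram ltqR gA wlam; rewrite g0 mxrank0 leqn0 cards_eq0 => /eqP/setP/(_ j).
rewrite !inE /lam mxE mulf_eq0 => /negbFE/orP[muj|]; last by rewrite subr_eq0 => /eqP.
have := congr1 (fun S : {set _} => j \in S) xQ.
by rewrite !inE muj (fintype.subsetP jQ) ?inE.
Qed.

(** The tensor enters the proof of uniqueness only through its contractions
    along the third mode. *)
Lemma polyadic_slices n (A : 'M[F]_(I, n)) (C : 'M[F]_(K, n)) (x : 'rV[F]_K) :
  \sum_k x 0 k *: polyadic A A C k = gram A (x *m C).
Proof.
apply/matrixP => i j; rewrite summxE gramE.
transitivity (\sum_k \sum_r x 0 k * (A i r * A j r * C k r)).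
  apply: eq_bigr => k _; rewrite mxE /polyadic sum_ffunE summxE mulr_sumr.
  by apply: eq_bigr => r _; rewrite ffunE !mxE.
rewrite exchange_big; apply: eq_bigr => r _ /=; rewrite mxE mulr_sumr mulr_suml.
by apply: eq_bigr => k _; ring.
Qed.

Definition rank1_terms n (A : 'M[F]_(I, n)) (C : 'M[F]_(K, n)) :=
  [seq outer3 (col r A) (col r A) (col r C) | r <- enum 'I_n].

Lemma decomposition_factors (T : {ffun 'I_K -> 'M[F]_I}) s : is_sfs_decomposition T s ->
  exists n (A : 'M[F]_(I, n)) (C : 'M[F]_(K, n)),
    s = rank1_terms A C /\ T = polyadic A A C.
Proof.
move=> [s1 ->].
have /choice[ac acP] (r : 'I_(size s)) : exists p : 'cV[F]_I * 'cV[F]_K,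
    s`_r = outer3 p.1 p.1 p.2.
  by have [a [c [_ _ ->]]] := s1 _ (mem_nth 0 (ltn_ord r)); exists (a, c).
exists (size s), (\matrix_(i, r) (ac r).1 i 0), (\matrix_(k, r) (ac r).2 k 0).
have colE r : outer3 (col r (\matrix_(i, r) (ac r).1 i 0)) (col r (\matrix_(i, r) (ac r).1 i 0))
    (col r (\matrix_(k, r) (ac r).2 k 0)) = s`_r.
  rewrite acP; congr (outer3 _ _ _); apply/colP => i; by rewrite !mxE.
split.
  rewrite /rank1_terms (eq_map colE) -[LHS](mkseq_nth 0) /mkseq -val_enum_ord -map_comp.
  exact: eq_map.
rewrite /polyadic (big_nth 0) big_mkord.
by apply: eq_bigr => r _; rewrite colE.
Qed.

(** If [x <> 0] and [x C'] has weight at most [q], then [x C] and [x C'] both have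
    weight [q]: the contraction has rank at most [q], so [x C] has weight at most
    [q], at least [q] because [x] kills fewer than [K] columns, and this weight is
    at most the rank, hence at most the weight of [x C'].  Applied to an [x] that
    kills [K - 1] columns of [C'], this forces the number of terms to be [R]. *)
Lemma decomposition_unique (A : 'M[F]_(I, R)) (C : 'M[F]_(K, R)) s :
  no_low_rank A q -> (forall x : 'rV[F]_K, x != 0 -> (#|killed C x| < K)%N) ->
  is_sfs_decomposition (polyadic A A C) s -> (size s <= R)%N ->
  perm_eq s (rank1_terms A C).
Proof.
move=> gA C_free /decomposition_factors[R' [A' [C' [-> TE]]]].
rewrite size_map size_enum_ord => leR' {s}.
have gE (x : 'rV[F]_K) : gram A (x *m C) = gram A' (x *m C').
  by rewrite -!polyadic_slices TE.
have key (x : 'rV[F]_K) : x != 0 -> (weight (x *m C') <= q)%N ->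
    weight (x *m C') = q /\ weight (x *m C) = q.
  move=> x0 wq; have := C_free x x0; have := weight_killed C x.
  have := leq_trans (rank_gram_le A' _) wq; rewrite -gE => /gA wCq.
  have ltqR : (q < R)%N by lia.
  have := weight_le_rank_gram ltqR gA wCq; rewrite gE.
  have := rank_gram_le A' (x *m C').
  card_lia.
(* The minimum allows for fewer than [K - 1] columns in [C']. *)
have eqR : R' = R.
  have [|S [_ SK]] := @exists_superset _ (finset.set0 : {set 'I_R'}) (minn K.-1 R').
    by rewrite cards0 card_ord geq_minr.
  have [|x [x0 _ Sx]] := @exists_killing _ _ _ _ C C' finset.set0 S.
    by rewrite cards0 SK; lia.
  have wE := weight_killed C' x; have := subset_leq_card Sx; rewrite SK => leS.
  have [|wq _] := key x x0; card_lia.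
move: A' C' TE gE key {leR'}; rewrite eqR => A' C' TE gE key {R' eqR}.
have C'_free (x : 'rV[F]_K) : x != 0 -> (#|killed C' x| < K)%N.
  move=> x0; have wE := weight_killed C' x.
  by rewrite ltnNge; apply/negP => leK; have [|wq _] := key x x0; card_lia.
have hyp (x : 'rV[F]_K) : x != 0 -> (K.-1 <= #|killed C' x|)%N -> #|killed C x| = K.-1.
  move=> x0 leK; have wE' := weight_killed C' x; have wE := weight_killed C x.
  by have [|wq' wq] := key x x0; card_lia.
have [s [d dP]] := columns_proportional K_gt1 leKR C_free C'_free hyp.
have CE (x : 'rV[F]_K) j : (x *m C) 0 (s j) = (x *m C') 0 j * d j.
  by rewrite mulmx_colE (dP j).2 -scalemxAr mxE -mulmx_colE mulrC.
have gsA (x : 'rV[F]_K) : gram (col_perm s A) (\row_j ((x *m C') 0 j * (\row_j d j) 0 j)) =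
    gram A' (x *m C').
  rewrite -gE; apply/matrixP => i k; rewrite !gramE [RHS](reindex_inj (@perm_inj _ s)).
  by apply: eq_bigr => r _; rewrite CE; move: (x *m C') => y; rewrite !mxE.
have d0 j : (\row_j d j) 0 j != 0 by rewrite mxE (dP j).1.
have eP := factors_proportional (no_low_rank_perm (s := s) gA) C'_free d0 gsA.
pose f r := outer3 (col r A) (col r A) (col r C).
have -> : rank1_terms A' C' = map f (map s (enum 'I_R)).
  rewrite -map_comp; apply: eq_map => r /=; have [e [eA]] := eP r; rewrite mxE => de.
  rewrite /f (dP r).2 de; apply/ffunP => k; apply/matrixP => i j; rewrite !ffunE !mxE.
  have eAE l : A' l r = e * A l (s r) by have /colP/(_ l) := eA; rewrite !mxE.
  by rewrite !eAE; ring.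
apply/perm_map/uniq_perm; rewrite ?(map_inj_uniq perm_inj) ?enum_uniq //.
move=> r; rewrite mem_enum; apply/mapP; exists ((s^-1)%g r); rewrite ?mem_enum //.
by rewrite permKV.
Qed.

Lemma sfs_cpd_unique_generic (A : 'M[F]_(I, R)) (C : 'M[F]_(K, R)) :
  no_low_rank A q -> (forall x : 'rV[F]_K, x != 0 -> (#|killed C x| < K)%N) ->
  sfs_cpd_unique (polyadic A A C).
Proof.
move=> gA C_free s1 s2 [ds1 rs1] [ds2 rs2].
have dec : is_sfs_decomposition (polyadic A A C) (rank1_terms A C).
  split; last by rewrite big_map big_enum.
  move=> t /mapP[r _ ->]; exists (col r A), (col r C); split=> //.
    apply/eqP => Ar.
    have /colP/(_ r) : delta_mx r 0 = 0 :> 'cV[F]_R.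
      apply: (no_low_rank_free (S := [set r]) _ gA); rewrite ?cards1 -?colE //; first lia.
      by move=> l; rewrite inE !mxE => /negbTE ->.
    by rewrite !mxE !eqxx => /eqP; rewrite oner_eq0.
  exact: col_neq0 (ltnW K_gt1) leKR C_free.
have sizeR : size (rank1_terms A C) = R by rewrite size_map size_enum_ord.
have s1R : (size s1 <= R)%N by rewrite -sizeR; apply: rs1.2.
have s2R : (size s2 <= R)%N by rewrite -sizeR; apply: rs2.2.
rewrite (permPl (decomposition_unique gA C_free ds1 s1R)) perm_sym.
exact: decomposition_unique gA C_free ds2 s2R.
Qed.
End Uniqueness.

(** * Parameters for the Gram matrices of low rank *)

Lemma card_cocodom (S T : finType) (phi : S -> T) : injective phi ->
  (#|{: {t | t \notin codom phi}}| + #|S| = #|T|)%N.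
Proof.
by move=> inj; rewrite card_sig -(cardC [in codom phi]) card_codom // addnC.
Qed.

Lemma big_cocodom (F : nmodType) (S T : finType) (phi : S -> T) (a : T -> F) :
  injective phi ->
  \sum_t a t = \sum_s a (phi s) + \sum_(t | t \notin codom phi) a t.
Proof.
move=> inj; rewrite (bigID [in codom phi]) /=; congr (_ + _).
transitivity (\sum_(s in [set: S]) a (phi s)); last by apply: eq_bigl => s; rewrite inE.
rewrite -(big_imset (h := phi) a) /=; last by move=> s s' _ _; exact: inj.
by apply: eq_bigl => t; apply/codomP/imsetP => -[s]; [move=> ->|move=> _ ->]; exists s.
Qed.

Lemma card_lower_triangle p : #|{: {x : 'I_p * 'I_p | (x.2 < x.1)%N}}| = 'C(p, 2).
Proof.
rewrite card_sig -sum1_card -bin2_sum big_mkord.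
rewrite -(pair_big_dep xpredT (fun i j : 'I_p => j < i)%N (fun _ _ => 1%N)) /=.
apply: eq_bigr => i _; rewrite -(big_ord_widen p (fun=> 1%N)) ?sum1_card ?card_ord //.
exact: ltnW.
Qed.

(** One step of the solution of a triangular linear system. *)
Lemma rational_solve (F : fieldType) (Omega : Type) (Gamma : finType)
    (gen : Gamma -> Omega -> F) p (j : 'I_p) (c u : 'I_p -> Omega -> F) s :
  (forall w, \sum_k c k w * u k w + s w = 0) ->
  (forall (k : 'I_p) w, (j < k)%N -> c k w = 0) -> (forall w, c j w != 0) ->
  (forall k : 'I_p, (k <= j)%N -> rational_in gen (c k)) ->
  (forall k : 'I_p, (k < j)%N -> rational_in gen (u k)) ->
  rational_in gen s -> rational_in gen (u j).
Proof.
move=> cu c0 cj rc ru rs.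
have rinv := rational_inv cj (rc j (leqnn j)).
have rsum : rational_in gen (fun w => \sum_(k < p | (k < j)%N) c k w * u k w).
  apply: rational_sum => k kj; apply: rational_mul; last exact: ru.
  exact: rc (ltnW kj).
apply: rational_eq (rational_mul rinv (rational_opp (rational_add rsum rs))) => w.
have := cu w; rewrite (bigD1 j) //= (bigID (fun k : 'I_p => (k < j)%N)) /=.
rewrite [X in _ + (_ + X)]big1 => [|k /andP[kj]]; last first.
  move=> nkj; rewrite c0 ?mul0r // ltn_neqAle leqNgt nkj andbT eq_sym.
  exact: kj.
rewrite addr0 -addrA (eq_bigl (fun k : 'I_p => (k < j)%N)) => [|k]; last first.
  by rewrite andbC; apply/andb_idr => kj; rewrite -(inj_eq val_inj) /= neq_ltn kj.
by move/eqP; rewrite addr_eq0 => /eqP <-; rewrite mulKf.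
Qed.

(** The hypotheses below describe a matrix [A] for which [N A diag(lam) A^T = 0],
    after the rows of [N A] have been replaced by the basis [V] of their span
    that is lower unitriangular in the columns [g] and upper triangular in the
    columns [f], with [G] as the change of basis. *)
Section DegenerateGram.
Variables (F : fieldType) (Omega : Type) (I R p : nat).
Variables (h : 'I_p -> 'I_I) (g f : 'I_p -> 'I_R) (r0 : 'I_R).
Hypotheses (h_inj : injective h) (g_inj : injective g) (f_inj : injective f).
Hypotheses (fg : forall i, f i \notin codom g) (r0g : r0 \notin codom g).
Variables (A : Omega -> 'M[F]_(I, R)) (lam : Omega -> 'rV[F]_R).
Variables (N : Omega -> 'M[F]_(p, I)) (G : Omega -> 'M[F]_p) (V : Omega -> 'M[F]_(p, R)).
Hypotheses (Nh : forall w i j, N w i (h j) = (i == j)%:R).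
Hypotheses (NA : forall w, N w *m A w = G w *m V w).
Hypotheses (Vg1 : forall w i, V w i (g i) = 1).
Hypotheses (Vg0 : forall w (i j : 'I_p), (i < j)%N -> V w i (g j) = 0).
Hypotheses (Vf0 : forall w (i j : 'I_p), (j < i)%N -> V w i (f j) = 0).
Hypotheses (lamg : forall w j, lam w 0 (g j) != 0) (lamr0 : forall w, lam w 0 r0 = 1).
Hypotheses (VV : forall w i j, \sum_r lam w 0 r * V w i r * V w j r = 0).
Hypotheses (VA : forall w i k, \sum_r lam w 0 r * V w i r * A w k r = 0).

(** The entries of [V] that do not serve as parameters. *)
Let Phi (s : 'I_p * 'I_p + {x : 'I_p * 'I_p | (x.2 < x.1)%N}) : 'I_p * 'I_R :=
  match s with inl x => (x.1, g x.2) | inr x => ((val x).1, f (val x).2) end.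

Let Phi_inj : injective Phi.
Proof.
move=> [[i j]|[[i j] ij]] [[i' j']|[[i' j'] ij']] [] /= ii' jj'.
- by rewrite ii' (g_inj jj').
- by have := fg j'; rewrite -jj' codom_f.
- by have := fg j; rewrite jj' codom_f.
- by congr inr; apply: val_inj; rewrite /= ii' (f_inj jj').
Qed.

Let g0 (s : option 'I_p) : 'I_R := if s is Some i then g i else r0.

Let g0_inj : injective g0.
Proof.
move=> [i|] [j|] //= => [/g_inj -> //|gr|rg].
- by have := r0g; rewrite -gr codom_f.
- by have := r0g; rewrite rg codom_f.
Qed.

Let Gamma : finType := ('I_p * {i | i \notin codom h} + 'I_p * 'I_p +
  {x | x \notin codom Phi} + {i | i \notin codom h} * {r | r \notin codom g} +
  {r | r \notin codom g0})%type.

Let gen (s : Gamma) (w : Omega) : F :=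
  match s with
  | inl (inl (inl (inl x))) => N w x.1 (val x.2)
  | inl (inl (inl (inr x))) => G w x.1 x.2
  | inl (inl (inr x)) => V w (val x).1 (val x).2
  | inl (inr x) => A w (val x.1) (val x.2)
  | inr x => lam w 0 (val x)
  end.

Let card_Gamma : (0 < p)%N -> (R <= 'C(p.+1, 2))%N -> (#|Gamma| < I * R)%N.
Proof.
move=> p_gt0 leR.
have h_card := card_cocodom h_inj; have g_card := card_cocodom g_inj.
have Phi_card := card_cocodom Phi_inj; have g0_card := card_cocodom g0_inj.
rewrite /Gamma !card_sum !card_prod; move: h_card g_card Phi_card g0_card leR.
rewrite card_sum !card_prod card_lower_triangle card_option !card_ord binS bin1.
move: #|{: {t | t \notin codom h}}| #|{: {t | t \notin codom g}}|
  #|{: {t | t \notin codom Phi}}| #|{: {t | t \notin codom g0}}| => a b c d.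
by move=> <- <- Phi_card g0_card leR; nia.
Qed.

(** The isotropy of the rows of [V] is an identity
    [T diag(lam_g) T^T = - Z diag(lam') Z^T], where [T] is the block [g] of [V],
    and [Z] and [lam'] are what lies outside [g].  As [T] is lower unitriangular,
    this is the decomposition of a symmetric matrix that Gaussian elimination
    computes, so that [T] and [lam_g] are rational in [Z] and [lam'].  The
    orthogonality of [V] to the rows of [A] then gives the columns [g] of [A],
    and [N A = G V] gives its rows [h]. *)
Lemma degenerate_gram_dependent : (0 < p)%N -> (R <= 'C(p.+1, 2))%N ->
  algebraically_dependent (fun (x : 'I_I * 'I_R) w => A w x.1 x.2).
Proof.
move=> p_gt0 leR; exists Gamma, gen; split; first by rewrite card_prod !card_ord card_Gamma.
have rN i k : rational_in gen (fun w => N w i k).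
  have [/codomP[j ->]|hk] := boolP (k \in codom h).
    by apply: rational_eq (rational_cst _ (i == j)%:R) => w; rewrite Nh.
  exact: (rational_gen gen (inl (inl (inl (inl (i, exist _ k hk)))))).
have rG i j : rational_in gen (fun w => G w i j).
  exact: (rational_gen gen (inl (inl (inl (inr (i, j)))))).
have rVoff i r : r \notin codom g -> rational_in gen (fun w => V w i r).
  move=> gr; have [/codomP[[[i' j]|[[i' j] ji]] [-> rE]]|Pr] := boolP ((i, r) \in codom Phi).
  - by move: gr; rewrite rE codom_f.
  - by apply: rational_eq (rational_cst _ 0) => w; rewrite rE Vf0.
  - exact: (rational_gen gen (inl (inl (inr (exist _ (i, r) Pr))))).
have rlamoff r : r \notin codom g -> rational_in gen (fun w => lam w 0 r).
  move=> gr; have [/codomP[[j|] /= rE]|Pr] := boolP (r \in codom g0).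
  - by move: gr; rewrite rE codom_f.
  - by apply: rational_eq (rational_cst _ 1) => w; rewrite rE lamr0.
  - exact: (rational_gen gen (inr (exist _ r Pr))).
have rlamV (j : 'I_p) : rational_in gen (fun w => lam w 0 (g j)) /\
    forall i, rational_in gen (fun w => V w i (g j)).
  have [n] := ubnP j; elim: n j => // n IHn j /ltnSE jn.
  have rV1 (k : 'I_p) i : (k < j)%N -> rational_in gen (fun w => V w i (g k)).
    by move=> kj; case: (IHn k (leq_trans kj jn)).
  have rl1 (k : 'I_p) : (k < j)%N -> rational_in gen (fun w => lam w 0 (g k)).
    by move=> kj; case: (IHn k (leq_trans kj jn)).
  have rVj (k : 'I_p) : (k <= j)%N -> rational_in gen (fun w => V w j (g k)).
    rewrite leq_eqVlt => /predU1P[/val_inj ->|/rV1 //].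
    by apply: rational_eq (rational_cst _ 1) => w; rewrite Vg1.
  have rs i : rational_in gen
      (fun w => \sum_(r | r \notin codom g) lam w 0 r * V w i r * V w j r).
    by apply: rational_sum => r gr; do 2?apply: rational_mul; auto.
  have rlj : rational_in gen (fun w => lam w 0 (g j)).
    apply: (@rational_solve _ _ _ _ _ j (fun k w => V w j (g k) ^+ 2)
              (fun k w => lam w 0 (g k)) _ _ _ _ _ _ (rs j)) => //.
    - move=> w; rewrite -[RHS](VV w j j) [RHS](big_cocodom _ g_inj); congr (_ + _).
      by apply: eq_bigr => k _; ring.
    - by move=> k w jk; rewrite Vg0 // expr0n.
    - by move=> w; rewrite Vg1 expr1n oner_eq0.
    - by move=> k kj; apply: rational_eq (rational_mul (rVj k kj) (rVj k kj)) => w.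
  split=> // i.
  apply: (@rational_solve _ _ _ _ _ j (fun k w => lam w 0 (g k) * V w j (g k))
            (fun k w => V w i (g k)) _ _ _ _ _ _ (rs i)) => //.
  - move=> w; rewrite -[RHS](VV w i j) [RHS](big_cocodom _ g_inj); congr (_ + _).
    by apply: eq_bigr => k _; ring.
  - by move=> k w jk; rewrite Vg0 // mulr0.
  - by move=> w; rewrite Vg1 mulr1.
  - move=> k kj; apply: rational_mul; last exact: rVj.
    by move: kj; rewrite leq_eqVlt => /predU1P[/val_inj ->|/rl1].
  - by move=> k kj; apply: rV1.
have rl r : rational_in gen (fun w => lam w 0 r).
  have [/codomP[j ->]|/rlamoff //] := boolP (r \in codom g).
  by case: (rlamV j).
have rV i r : rational_in gen (fun w => V w i r).
  have [/codomP[j ->]|/rVoff //] := boolP (r \in codom g).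
  by case: (rlamV j).
have rA k r : k \notin codom h -> rational_in gen (fun w => A w k r).
  move=> hk.
  have rAoff s : s \notin codom g -> rational_in gen (fun w => A w k s).
    by move=> gs; exact: (rational_gen gen (inl (inr (exist _ k hk, exist _ s gs)))).
  have [/codomP[j ->]|/rAoff //] := boolP (r \in codom g).
  have [n] := ubnP j; elim: n j => // n IHn j /ltnSE jn.
  have rs : rational_in gen
      (fun w => \sum_(r | r \notin codom g) lam w 0 r * V w j r * A w k r).
    by apply: rational_sum => s gs; do 2?apply: rational_mul; auto.
  apply: (@rational_solve _ _ _ _ _ j (fun l w => lam w 0 (g l) * V w j (g l))
            (fun l w => A w k (g l)) _ _ _ _ _ _ rs) => //.
  - by move=> w; rewrite -[RHS](VA w j k) [RHS](big_cocodom _ g_inj).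
  - by move=> l w jl; rewrite Vg0 // mulr0.
  - by move=> w; rewrite Vg1 mulr1.
  - by move=> l lj; apply: rational_mul.
  - by move=> l lj; exact: IHn (leq_trans lj jn).
move=> [i r] /=; have [/codomP[j ->]|hi] := boolP (i \in codom h); last exact: rA.
have rGV : rational_in gen (fun w => \sum_k G w j k * V w k r).
  by apply: rational_sum => k _; exact: rational_mul.
have rNA : rational_in gen (fun w => \sum_(k | k \notin codom h) N w j k * A w k r).
  by apply: rational_sum => k hk; apply: rational_mul; [exact: rN|exact: rA].
apply: rational_eq (rational_add rGV (rational_opp rNA)) => w.
have /matrixP/(_ j r) := NA w; rewrite !mxE => <-.
rewrite (big_cocodom _ h_inj) addrK (bigD1 j) //= Nh eqxx mul1r big1 ?addr0 //.
by move=> k /negbTE kj; rewrite Nh eq_sym kj mul0r.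
Qed.
End DegenerateGram.

(** * A normal form for the Gram matrices of low rank *)

Section NormalForm.
Variable F : fieldType.

(** The factorization [P M^T = L U] with [L] unitriangular gives
    [M P^T = U^T L^T], and [T] is the inverse of the lower triangular matrix
    [U^T], rescaled to have a unit diagonal. *)
Lemma lower_upper_perm n (M : 'M[F]_n) : M \in unitmx ->
  exists (s : {perm 'I_n}) (T : 'M[F]_n),
  [/\ T \in unitmx, forall i, T i i = 1, forall i j : 'I_n, (i < j)%N -> T i j = 0
    & forall i j : 'I_n, (j < i)%N -> (T *m M) i (s j) = 0].
Proof.
case: n M => [|n] M uM.
  exists 1%g, 1%:M; split; rewrite ?unitmx1 //; by move=> [].
have := cormen_lup_correct M^T; have := @cormen_lup_lower _ _ M^T.
have := @cormen_lup_upper _ _ M^T; have := cormen_lup_perm M^T.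
case: (cormen_lup M^T) => [[P L] U] /= /is_perm_mxP[s ->] U0 L0 PM.
rewrite -!mulmxE in PM; pose B := U^T.
have BE : M *m (perm_mx s)^T = B *m L^T by rewrite -[M]trmxK -!trmx_mul PM.
have B0 (i j : 'I_n.+1) : (i < j)%N -> B i j = 0 by move=> ij; rewrite mxE U0.
have uBL : B *m L^T \in unitmx.
  by rewrite -BE unitmx_mul uM unitmx_tr unitmx_perm.
have /andP[uB uL] : (B \in unitmx) && (L^T \in unitmx) by rewrite -unitmx_mul.
have Bii i : B i i != 0.
  have := uB; rewrite unitmxE unitfE det_trig; last by apply/is_trig_mxP.
  by move/prodf_neq0; apply.
clearbody B; pose X := invmx B.
have BX : B *m X = 1%:M by rewrite mulmxV.
have X0 (i j : 'I_n.+1) : (i < j)%N -> X i j = 0.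
  have [m] := ubnP i; elim: m i => // m IHm i /ltnSE im ij.
  have /matrixP/(_ i j) := BX; rewrite !mxE (bigD1 i) //= big1 ?addr0 => [|k ki].
    move/eqP; rewrite -[i == j](inj_eq val_inj) (ltn_eqF ij) mulf_eq0 (negbTE (Bii i)).
    by move/eqP.
  have [ik|ik] := ltnP i k; first by rewrite B0 // mul0r.
  have {}ki : (k < i)%N by rewrite ltn_neqAle ik andbT; exact: ki.
  by rewrite IHm ?mulr0 //; [exact: leq_trans ki im|exact: ltn_trans ki ij].
have Xii i : B i i * X i i = 1.
  have /matrixP/(_ i i) := BX; rewrite !mxE eqxx (bigD1 i) //= big1 ?addr0 // => k ki.
  have [ik|ik] := ltnP i k; first by rewrite B0 // mul0r.
  by rewrite X0 ?mulr0 // ltn_neqAle ik andbT; exact: ki.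
pose D : 'rV[F]_n.+1 := \row_i B i i.
exists s, (diag_mx D *m X); split.
- rewrite unitmx_mul unitmx_inv uB andbT unitmxE unitfE det_diag.
  by apply/prodf_neq0 => i _; rewrite mxE.
- by move=> i; rewrite mul_diag_mx mxE mxE Xii.
- by move=> i j ij; rewrite mul_diag_mx mxE X0 ?mulr0.
move=> i j ji.
have -> : (diag_mx D *m X *m M) i (s j) = (diag_mx D *m X *m M *m (perm_mx s)^T) i j.
  by rewrite tr_perm_mx -col_permE [RHS]mxE.
rewrite -mulmxA BE -mulmxA mulKmx // mul_diag_mx mxE [L^T i j]mxE L0; last exact: ltnW.
by rewrite -(inj_eq val_inj) /= ltn_eqF ?mulr0.
Qed.

Lemma row_free_colsub m n (M : 'M[F]_(m, n)) : row_free M ->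
  exists h : 'I_m -> 'I_n, injective h /\ colsub h M \in unitmx.
Proof.
move=> fM; have fMT : row_full M^T by rewrite /row_full mxrank_tr.
exists (fullrankfun fMT); split; first exact: fullrankfun_inj.
by rewrite -unitmx_tr trmx_mxsub; exact: fullrowsub_unit.
Qed.

Lemma exists_injection (T : finType) (S : {set T}) n : (n <= #|S|)%N ->
  exists phi : 'I_n -> T, injective phi /\ forall i, phi i \in S.
Proof.
move=> leS; exists (fun i => enum_val (widen_ord leS i)); split=> [i j|i].
  by move=> /enum_val_inj /(congr1 val) /= /val_inj.
exact: enum_valP.
Qed.

Definition maximal_minors_unit m n (A : 'M[F]_(m, n)) :=
  forall phi : 'I_m -> 'I_n, injective phi -> colsub phi A \in unitmx.

Lemma card_killed m n (A : 'M[F]_(m, n)) (x : 'rV[F]_m) :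
  maximal_minors_unit A -> x != 0 -> (#|killed A x| < m)%N.
Proof.
move=> uA; rewrite ltnNge; apply: contraNN => /exists_injection[phi [phi_inj xphi]].
apply/eqP; rewrite -[x](mulmxK (uA _ phi_inj)).
rewrite (_ : x *m colsub phi A = 0) ?mul0mx //.
apply/rowP => j; rewrite [RHS]mxE.
have := xphi j; rewrite inE => /eqP <-.
by rewrite !mxE; apply: eq_bigr => i _; rewrite mxE.
Qed.

Lemma colsub_mul_diag m n k (f : 'I_k -> 'I_n) (M : 'M[F]_(m, n)) lam :
  colsub f (M *m diag_mx lam) = colsub f M *m diag_mx (colsub f lam).
Proof. by apply/matrixP => i j; rewrite mxE !mul_mx_diag !mxE. Qed.

Lemma full_weight_rank m n (A : 'M[F]_(m, n)) mu : maximal_minors_unit A ->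
  weight mu = m -> \rank (gram A mu) = m.
Proof.
move=> uA wmu; have [phi [phi_inj mu_phi]] :
    exists phi : 'I_m -> 'I_n, injective phi /\ forall i, phi i \in [set r | mu 0 r != 0].
  by apply: exists_injection; rewrite -/(weight mu) wmu.
have phiE r : r \notin codom phi -> mu 0 r = 0.
  move=> rphi; apply/eqP; apply: contraNT rphi => mur.
  have /subset_cardP : #|codom phi| = #|[set r | mu 0 r != 0]|.
    by rewrite card_codom // card_ord -/(weight mu) wmu.
  have sub : codom phi \subset [set r | mu 0 r != 0].
    by apply/fintype.subsetP => k /codomP[i ->].
  by move/(_ sub) => ->; rewrite inE.
have -> : gram A mu = colsub phi A *m diag_mx (colsub phi mu) *m (colsub phi A)^T.
  apply/matrixP => i j; rewrite -/(gram (colsub phi A) _) !gramE (big_cocodom _ phi_inj).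
  rewrite [X in _ + X]big1 ?addr0 => [|r /phiE ->]; last by rewrite mulr0 mul0r.
  by apply: eq_bigr => r _; rewrite !mxE.
apply: mxrank_unit; rewrite !unitmx_mul unitmx_tr uA //= andbT unitmxE unitfE det_diag.
by apply/prodf_neq0 => i _; rewrite mxE; have := mu_phi i; rewrite inE.
Qed.

(** In this form the condition [N A diag(lam) A^T = 0] has rational solutions in
    terms of independent parameters; the zeros imposed on [V] in the columns [f]
    use up the freedom in the choice of a unitriangular basis change. *)
Record degenerate_normal_form m n p (h : 'I_p -> 'I_m) (g f : 'I_p -> 'I_n) (r0 : 'I_n)
    (A : 'M[F]_(m, n)) (lam : 'rV[F]_n) (N : 'M[F]_(p, m)) (G : 'M[F]_p)
    (V : 'M[F]_(p, n)) : Prop := DegenerateNormalForm {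
  dnf_h : injective h;
  dnf_g : injective g;
  dnf_f : injective f;
  dnf_fg : forall i, f i \notin codom g;
  dnf_r0g : r0 \notin codom g;
  dnf_Nh : forall i j, N i (h j) = (i == j)%:R;
  dnf_NA : N *m A = G *m V;
  dnf_Vg1 : forall i, V i (g i) = 1;
  dnf_Vg0 : forall i j : 'I_p, (i < j)%N -> V i (g j) = 0;
  dnf_Vf0 : forall i j : 'I_p, (j < i)%N -> V i (f j) = 0;
  dnf_lamg : forall j, lam 0 (g j) != 0;
  dnf_lamr0 : lam 0 r0 = 1;
  dnf_VV : forall i j, \sum_r lam 0 r * V i r * V j r = 0;
  dnf_VA : forall i k, \sum_r lam 0 r * V i r * A k r = 0 }.

(** The rows of [N] are taken in the kernel of the Gram matrix and reduced to an
    identity block in the columns [h].  The rows of [N A] stay independent after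
    the multiplication by [diag(lam)], whose support is larger than [m - 1],
    which provides columns [g] where [lam] does not vanish and a change of basis
    to rows [V0] that form an identity block there.  Let [V0'] and [lam'] be the
    parts of [V0] and [lam] outside [g].  Isotropy then reads
    [V0' diag(lam') V0'^T = - diag(lam_g)], so that [V0'] has rank [p] and
    contains another invertible block, made triangular by a permutation and a
    unitriangular change of basis. *)
Lemma exists_normal_form m n p q (A : 'M[F]_(m, n)) (lam : 'rV[F]_n) :
  (0 < p)%N -> (q + p = m)%N -> (m <= n)%N -> maximal_minors_unit A ->
  (\rank (gram A lam) <= q)%N -> (q < weight lam)%N ->
  exists h g f r0 lam' N G V, @degenerate_normal_form m n p h g f r0 A lam' N G V.
Proof.
move=> p_gt0 qpm lemn uA rk_le weight_gt.
(* Otherwise adding terms up to weight [m] would keep the rank below [m]. *)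
have weight_ge : (m <= weight lam)%N.
  rewrite leqNgt; apply/negP => lt_wt.
  have [|mu [wmu rmu]] := @gram_extend _ _ _ A lam m; first by rewrite ltnW.
  by move: rmu; rewrite full_weight_rank //; lia.
have [N [h [h_inj Nh NAA]]] : exists (N : 'M[F]_(p, m)) (h : 'I_p -> 'I_m),
    [/\ injective h, forall i j, N i (h j) = (i == j)%:R & N *m gram A lam = 0].
  pose W := row_base (kermx (gram A lam)).
  have [h [h_inj uW]] := row_free_colsub (row_base_free (kermx (gram A lam))).
  have lep : (p <= \rank (kermx (gram A lam)))%N by rewrite mxrank_ker; lia.
  have W0 : W *m gram A lam = 0 by apply/sub_kermxP; rewrite eq_row_base.
  pose N1 := invmx (colsub h W) *m W.
  exists (rowsub (widen_ord lep) N1), (fun j => h (widen_ord lep j)); split.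
  - by move=> i j /h_inj /(congr1 val) /= /val_inj.
  - move=> i j; have /matrixP/(_ (widen_ord lep i) (widen_ord lep j)) := mulVmx uW.
    rewrite -[X in _ = (X : bool)%:R]/(val (widen_ord lep i) == val (widen_ord lep j)).
    move=> /esym; rewrite !mxE => ->; apply: eq_bigr => k _; by rewrite !mxE.
  - by rewrite -mul_rowsub_mx /N1 -mulmxA W0 mulmx0; apply/matrixP => i j; rewrite !mxE.
have [U UE] : exists U, U = N *m A by exists (N *m A).
have UA : U *m diag_mx lam *m A^T = 0 by rewrite UE -NAA /gram !mulmxA.
have [g [g_inj uUlam]] : exists g : 'I_p -> 'I_n,
    injective g /\ colsub g (U *m diag_mx lam) \in unitmx.
  apply/row_free_colsub/inj_row_free => z zU.
  have [z0|] := eqVneq (z *m N) 0.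
    apply/rowP => j; have /rowP/(_ (h j)) := z0.
    rewrite !mxE (bigD1 j) //= Nh eqxx mulr1 big1 ?addr0 // => k kj.
    by rewrite Nh (negbTE kj) mulr0.
  move=> /(card_killed uA); rewrite ltnNge => /negP[]; apply: leq_trans weight_ge _.
  apply/subset_leq_card/fintype.subsetP => r; rewrite !inE => lr.
  have /rowP/(_ r) := zU; rewrite mulmxA mul_mx_diag mxE [RHS]mxE UE mulmxA => /eqP.
  by rewrite mulf_eq0 (negbTE lr) orbF.
have [uUg lamg] : colsub g U \in unitmx /\ forall j, lam 0 (g j) != 0.
  move: uUlam; rewrite colsub_mul_diag unitmx_mul => /andP[-> uD]; split=> // j.
  by move: uD; rewrite unitmxE unitfE det_diag => /prodf_neq0/(_ j isT); rewrite mxE.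
have [V0 V0E] : exists V0, V0 = invmx (colsub g U) *m U by exists (invmx (colsub g U) *m U).
have V0A : V0 *m diag_mx lam *m A^T = 0 by rewrite V0E -!mulmxA (mulmxA U) UA mulmx0.
have V0V0 : V0 *m diag_mx lam *m V0^T = 0.
  by rewrite {2}V0E UE !trmx_mul !mulmxA V0A !mul0mx.
have V0g i j : V0 i (g j) = (i == j)%:R.
  have /matrixP/(_ i j) := mulVmx uUg; rewrite mulmx_colsub -V0E mxE => ->.
  by rewrite mxE.
(* Isotropy off the columns [g]: the diagonal matrix on the right of [M0V0] is
   invertible, so [M0] has rank [p]. *)
pose M0 := \matrix_(i, r) (if r \in codom g then 0 else V0 i r * lam 0 r).
have M0V0 : M0 *m V0^T = - diag_mx (colsub g lam).
  apply/eqP; rewrite -subr_eq0 opprK; apply/eqP/matrixP => i j.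
  have /matrixP/(_ i j) := V0V0; rewrite [RHS]mxE => V0ij; rewrite [RHS]mxE -V0ij.
  rewrite mxE mxE [RHS]mxE !(big_cocodom _ g_inj) big1 ?add0r => [|k _]; last first.
    by rewrite mxE codom_f mul0r.
  rewrite addrC; congr (_ + _).
    rewrite (bigD1 i) //= big1 ?addr0 => [|k ki].
      by rewrite mul_mx_diag !mxE !V0g eqxx mul1r eq_sym mulr_natr.
    by rewrite mul_mx_diag mxE V0g eq_sym (negbTE ki) !mul0r.
  by apply: eq_bigr => r /negbTE gr; rewrite mul_mx_diag [M0 _ _]mxE [in RHS]mxE gr.
have [f0 [f0_inj uM0]] : exists f : 'I_p -> 'I_n, injective f /\ colsub f M0 \in unitmx.
  apply/row_free_colsub/inj_row_free => z zM0.
  have : z *m diag_mx (colsub g lam) = 0 by rewrite -[LHS]opprK -mulmxN -M0V0 mulmxA zM0 mul0mx oppr0.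
  move=> /rowP zg; apply/rowP => j; have := zg j; rewrite mul_mx_diag !mxE => /eqP.
  by rewrite mulf_eq0 (negbTE (lamg j)) orbF => /eqP.
have M0f j : exists i, M0 i (f0 j) != 0.
  apply/existsP; apply: contraTT uM0 => /existsPn M00.
  rewrite unitmxE unitfE negbK (expand_det_col _ j) big1 // => i _.
  by rewrite mxE (eqP (negPn (M00 i))) mul0r.
have f0g j : f0 j \notin codom g.
  by have [l Ml] := M0f j; apply: contra_neqN Ml => gf; rewrite mxE gf.
have lamf0 j : lam 0 (f0 j) != 0.
  by have [l Ml] := M0f j; apply: contra_neq Ml => lf; rewrite mxE lf mulr0 if_same.
have uV0f : colsub f0 V0 \in unitmx.
  have : colsub f0 M0 = colsub f0 V0 *m diag_mx (colsub f0 lam).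
    by apply/matrixP => i j; rewrite mul_mx_diag !mxE (negbTE (f0g j)).
  by move=> M0E; move: uM0; rewrite M0E unitmx_mul => /andP[].
have [s [T [uT T1 T0 TV0]]] := lower_upper_perm uV0f.
pose c := lam 0 (f0 (s (Ordinal p_gt0))).
have c0 : c != 0 by exact: lamf0.
have TVg i j : (T *m V0) i (g j) = T i j.
  rewrite mxE (bigD1 j) //= V0g eqxx mulr1 big1 ?addr0 // => k kj.
  by rewrite V0g (negbTE kj) mulr0.
have sumE (X : 'M[F]_(p, n)) k (Y : 'M[F]_(k, n)) i j :
    \sum_r (c^-1 *: lam) 0 r * X i r * Y j r = c^-1 * (X *m diag_mx lam *m Y^T) i j.
  rewrite mxE mulr_sumr; apply: eq_bigr => r _.
  by rewrite mul_mx_diag !mxE; ring.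
exists h, g, (fun j => f0 (s j)), (f0 (s (Ordinal p_gt0))), (c^-1 *: lam), N,
  (colsub g U *m invmx T), (T *m V0); split=> //.
- by move=> i j /f0_inj /perm_inj.
- by rewrite -mulmxA (mulmxA _ T) mulVmx // mul1mx V0E mulKVmx -?UE.
- by move=> i; rewrite TVg.
- by move=> i j ij; rewrite TVg T0.
- by move=> i j ji; have := TV0 i j ji; rewrite mulmx_colsub mxE.
- by move=> j; rewrite mxE mulf_neq0 // invr_eq0.
- by rewrite mxE mulVf.
- move=> i j; rewrite sumE trmx_mul -!mulmxA (mulmxA V0) (mulmxA _ V0^T) V0V0.
  by rewrite mul0mx mulmx0 mxE mulr0.
- by move=> i k; rewrite sumE -!mulmxA (mulmxA V0) V0A mulmx0 mxE mulr0.
Qed.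
End NormalForm.

(** * Genericity *)

Section ThinLoci.
Local Open Scope classical_set_scope.
Variables (F : fieldType) (n I R : nat) (idx : 'I_I * 'I_R -> 'I_n).
Hypothesis idx_inj : injective idx.

Let mat (v : 'rV[F]_n) : 'M[F]_(I, R) := \matrix_(i, r) v 0 (idx (i, r)).

Lemma thin_image_sub (Omega : Type) (x : Omega -> 'rV[F]_n) (kappa : finType)
    (f : kappa -> 'I_I * 'I_R) (B : set 'rV[F]_n) : injective f ->
  algebraically_dependent (fun k w => x w 0 (idx (f k))) ->
  (forall v, B v -> exists w, v = x w) -> thin B.
Proof.
move=> f_inj dx Bx.
have dx' : algebraically_dependent (fun j w => x w 0 j).
  exact: dependent_subfamily (inj_comp idx_inj f_inj) dx.
apply: thin_sub (thin_image dx') => v /Bx[w ->]; exists w => //.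
by apply/rowP => j; rewrite mxE.
Qed.

(** A singular block of [A] has a left null vector with one coordinate equal to
    [1]: the [I] entries of one row are determined by the other rows and by the
    remaining [I - 1] coordinates of this vector. *)
Lemma thin_singular_minor : thin [set v | ~ maximal_minors_unit (mat v)].
Proof.
pose B (c : {ffun 'I_I -> 'I_R} * 'I_I) : set 'rV[F]_n := [set v | injective c.1 /\
  exists2 y : 'rV[F]_I, y 0 c.2 = 1 & forall j, \sum_l y 0 l * v 0 (idx (l, c.1 j)) = 0].
apply: (@thin_sub _ _ _ (\bigcup_c B c)) => [v /existsNP[phi /not_implyP[phi_inj /negP]]|].
  rewrite -row_free_unit -kermx_eq0 => /rowV0Pn[y /sub_kermxP yM /rV0Pn[i yi]].
  exists ([ffun j => phi j], i) => //; split=> [j j'|]; first by rewrite !ffunE => /phi_inj.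
  exists ((y 0 i)^-1 *: y) => [|j]; first by rewrite mxE mulVf.
  have /rowP/(_ j) := yM; rewrite [RHS]mxE mxE => yMj.
  rewrite -[RHS](mulr0 (y 0 i)^-1) -[in RHS]yMj mulr_sumr.
  by apply: eq_bigr => l _; rewrite ffunE !mxE mulrA.
apply: thin_bigcup => -[phi i].
pose Omega := {vy : 'rV[F]_n * 'rV[F]_I | injective phi /\ vy.2 0 i = 1 /\
  forall j, \sum_l vy.2 0 l * vy.1 0 (idx (l, phi j)) = 0}.
have [phi_inj|nphi] := pselect (injective phi); last first.
  apply: (@thin_sub _ _ _ (\bigcup_(c : 'I_0) set0)) => [v [] //|].
  by apply: thin_bigcup => -[].
apply: (@thin_image_sub Omega (fun w => (sval w).1) _
    (fun x : 'I_I * 'I_I => (x.1, phi x.2))).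
- by move=> [l j] [l' j'] [] /= -> /phi_inj ->.
- pose gen (s : {l | l != i} * 'I_I + {l | l != i}) (w : Omega) : F := match s with
    | inl x => (sval w).1 0 (idx (val x.1, phi x.2)) | inr l => (sval w).2 0 (val l) end.
  exists ({l | l != i} * 'I_I + {l | l != i})%type, gen; split.
    rewrite card_sum !card_prod card_sig card_ord (cardC1 i) card_ord.
    by have := ltn_ord i; nia.
  move=> [l j] /=.
  have ry k : rational_in gen (fun w : Omega => (sval w).2 0 k).
    have [->|ki] := eqVneq k i.
      by apply: rational_eq (rational_cst _ 1) => w; have [_ []] := svalP w.
    exact: (rational_gen gen (inr (exist _ k ki))).
  have rv k : k != i -> rational_in gen (fun w : Omega => (sval w).1 0 (idx (k, phi j))).
    by move=> ki; exact: (rational_gen gen (inl (exist _ k ki, j))).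
  have [->|] := eqVneq l i; last exact: rv.
  have rs : rational_in gen (fun w : Omega => \sum_(k | k != i)
      (sval w).2 0 k * (sval w).1 0 (idx (k, phi j))).
    by apply: rational_sum => k ki; apply: rational_mul; [exact: ry|exact: rv].
  apply: rational_eq (rational_opp rs) => w; have [_ [yi yv]] := svalP w.
  by have := yv j; rewrite (bigD1 i) //= yi mul1r => /eqP; rewrite addr_eq0 => /eqP.
- by move=> v [_ [y yi yv]]; exists (exist _ (v, y) (conj phi_inj (conj yi yv))).
Qed.

Lemma thin_low_rank p q : (0 < p)%N -> (q + p = I)%N -> (I <= R)%N ->
  (R <= 'C(p.+1, 2))%N ->
  thin [set v | maximal_minors_unit (mat v) /\ ~ no_low_rank (mat v) q].
Proof.
move=> p_gt0 qpI leIR leR.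
pose B (c : {ffun 'I_p -> 'I_I} * {ffun 'I_p -> 'I_R} * {ffun 'I_p -> 'I_R} * 'I_R) :
    set 'rV[F]_n := [set v | exists lam N G V,
  degenerate_normal_form c.1.1.1 c.1.1.2 c.1.2 c.2 (mat v) lam N G V].
apply: (@thin_sub _ _ _ (\bigcup_c B c)).
  move=> v [uA /existsNP[lam /not_implyP[rk /negP]]]; rewrite -ltnNge => weight_gt.
  have [h [g [f [r0 [lam' [N [G [V nf]]]]]]]] :=
    exists_normal_form p_gt0 qpI leIR uA rk weight_gt.
  exists ([ffun j => h j], [ffun j => g j], [ffun j => f j], r0) => //.
  exists lam', N, G, V => /=.
  have finfunK m (u : 'I_p -> 'I_m) : fun_of_fin [ffun j => u j] = u.
    by apply/funext => j; rewrite ffunE.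
  by rewrite !finfunK.
apply: thin_bigcup => -[[[h g] f] r0].
pose Omega := {D : 'rV[F]_n * 'rV[F]_R * 'M[F]_(p, I) * 'M[F]_p * 'M[F]_(p, R) |
  degenerate_normal_form h g f r0 (mat D.1.1.1.1) D.1.1.1.2 D.1.1.2 D.1.2 D.2}.
have [[w0]|noO] := pselect (inhabited Omega); last first.
  apply: (@thin_sub _ _ _ (\bigcup_(c : 'I_0) set0)) => [v|]; last first.
    by apply: thin_bigcup => -[].
  move=> [lam [N [G [V nf]]]]; exfalso; apply: noO; constructor.
  by exists (v, lam, N, G, V).
apply: (@thin_image_sub Omega (fun w => (sval w).1.1.1.1) _ id) => //.
- have := @degenerate_gram_dependent F Omega I R p h g f r0
    (dnf_h (svalP w0)) (dnf_g (svalP w0)) (dnf_f (svalP w0)) (dnf_fg (svalP w0))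
    (dnf_r0g (svalP w0)) (fun w => mat (sval w).1.1.1.1) (fun w => (sval w).1.1.1.2)
    (fun w => (sval w).1.1.2) (fun w => (sval w).1.2) (fun w => (sval w).2)
    (fun w => dnf_Nh (svalP w)) (fun w => dnf_NA (svalP w)) (fun w => dnf_Vg1 (svalP w))
    (fun w => dnf_Vg0 (svalP w)) (fun w => dnf_Vf0 (svalP w)) (fun w => dnf_lamg (svalP w))
    (fun w => dnf_lamr0 (svalP w)) (fun w => dnf_VV (svalP w)) (fun w => dnf_VA (svalP w))
    p_gt0 leR.
  move=> [Gamma [gen [ltG rA]]]; exists Gamma, gen; split=> // -[i r].
  by apply: rational_eq (rA (i, r)) => w; rewrite mxE.
- by move=> v [lam [N [G [V nf]]]]; exists (exist _ (v, lam, N, G, V) nf).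
Qed.
End ThinLoci.

Lemma mxvec_index_inj m n : injective (fun x : 'I_m * 'I_n => mxvec_index x.1 x.2).
Proof.
move=> [i j] [i' j'] /= /(congr1 (fun k => vec_mx (delta_mx 0 k : 'rV[int]_(m * n)) i j)).
rewrite !vec_mx_delta !mxE !eqxx /=.
by case: eqP => [->|] //=; case: eqP => [->|].
Qed.

Lemma thin_sfs_cpd_not_unique (F : fieldType) (I K R p q : nat) :
  (1 < K)%N -> (I <= R)%N -> (K <= R)%N -> (q + K = R.+1)%N -> (q + p = I)%N ->
  (0 < p)%N -> (R <= 'C(p.+1, 2))%N -> thin (@sfs_cpd_not_unique F I K R).
Proof.
move=> K_gt1 leIR leKR qK qp p_gt0 leR.
pose idA (x : 'I_I * 'I_R) := lshift (K * R) (mxvec_index x.1 x.2).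
pose idC (x : 'I_K * 'I_R) := rshift (I * R) (mxvec_index x.1 x.2).
have idA_inj : injective idA by move=> x y /lshift_inj /mxvec_index_inj.
have idC_inj : injective idC by move=> x y /rshift_inj /mxvec_index_inj.
apply: thin_sub (thinU (@thin_singular_minor F _ _ _ _ idC_inj)
  (thinU (@thin_singular_minor F _ _ _ _ idA_inj)
         (@thin_low_rank F _ _ _ _ idA_inj p q p_gt0 qp leIR leR))).
move=> v; rewrite /sfs_cpd_not_unique /=.
have -> : vec_mx (lsubmx v) = \matrix_(i, r) v 0 (idA (i, r)).
  by apply/matrixP => i r; rewrite !mxE.
have -> : vec_mx (rsubmx v) = \matrix_(i, r) v 0 (idC (i, r)).
  by apply/matrixP => i r; rewrite !mxE.
set A := \matrix_(i, r) _; set C := \matrix_(i, r) _ => nu.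
have [uC|] := pselect (maximal_minors_unit C); last by left.
have [uA|] := pselect (maximal_minors_unit A); last by right; left.
right; right; split=> // gA; apply: nu.
apply: (sfs_cpd_unique_generic K_gt1 leKR qK gA) => x.
exact: card_killed.
Qed.

(** * The two forms of the bound *)

Section Bounds.
Variables (RT : realType) (I K R : nat).

(** With [n = I + K - R], squaring [sqrt (8 (I + K) + 1) <= 2 n + 1] gives
    [2 R <= n (n - 1)]. *)
Lemma square_root_bound_binomial : (0 < R)%N ->
  (R%:R <= (2 * I%:R + 2 * K%:R + 1 - Num.sqrt (8 * K%:R + 8 * I%:R + 1)) / 2 :> RT)
  <-> (R < I + K)%N /\ (R.*2 <= (I + K - R) * (I + K - R).-1)%N.
Proof.
move=> R_gt0; set s := Num.sqrt _.
have s_ge0 : 0 <= s by exact: sqrtr_ge0.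
have I0 : 0 <= I%:R :> RT by [].
have K0 : 0 <= K%:R :> RT by [].
have R1 : 1 <= R%:R :> RT by rewrite ler1n.
have sE : s ^+ 2 = 8 * K%:R + 8 * I%:R + 1 by rewrite sqr_sqrtr //; lra.
have binE : (R < I + K)%N -> (R.*2 <= (I + K - R) * (I + K - R).-1)%N =
    (8 * K%:R + 8 * I%:R + 1 <= (2 * I%:R + 2 * K%:R + 1 - 2 * R%:R) ^+ 2 :> RT).
  move=> ltR; have [k IKE] : exists k, (I + K = R + k.+1)%N.
    by exists (I + K - R).-1; lia.
  have IKR : I%:R = R%:R + k%:R + 1 - K%:R :> RT.
    by have := congr1 (GRing.natmul (1 : RT)) IKE; rewrite !natrD -natr1; lra.
  rewrite IKE addKn /= -(ler_nat RT) -muln2 !natrM -natr1 IKR.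
  by apply/idP/idP => h; nra.
split=> [leR|[ltR]].
  have leS : s <= 2 * I%:R + 2 * K%:R + 1 - 2 * R%:R by lra.
  have leS2 : 8 * K%:R + 8 * I%:R + 1 <= (2 * I%:R + 2 * K%:R + 1 - 2 * R%:R) ^+ 2 :> RT.
    by rewrite -sE; nra.
  have ltR : (R < I + K)%N.
    rewrite ltnNge; apply/negP; rewrite -(ler_nat RT) natrD => leIKR.
    nra.
  by rewrite binE.
rewrite binE // -sE => leS2.
have : s <= 2 * I%:R + 2 * K%:R + 1 - 2 * R%:R.
  rewrite -ler_sqr ?nnegrE //.
  by move: ltR; rewrite -(ltr_nat RT) natrD; lra.
lra.
Qed.

Lemma quadratic_bound_binomial :
  let m : int := R%:Z - K%:Z + 2 in
  (m - 1 <= I%:Z /\ R%:R <= (I%:R ^+ 2 + (3 - 2 * m%:~R) * I%:R) / 2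
              + (m%:~R - 1) * (m%:~R - 2) / 2 :> RT)
  <-> (R < I + K)%N /\ (R.*2 <= (I + K - R) * (I + K - R).-1)%N.
Proof.
move=> m.
have mE : m%:~R = R%:R - K%:R + 2 :> RT by rewrite /m rmorphD rmorphB.
have -> : (m - 1 <= I%:Z) = (R < I + K)%N by rewrite /m; lia.
suff binE : (R < I + K)%N -> (R.*2 <= (I + K - R) * (I + K - R).-1)%N =
    (R%:R <= (I%:R ^+ 2 + (3 - 2 * m%:~R) * I%:R) / 2
              + (m%:~R - 1) * (m%:~R - 2) / 2 :> RT).
  by split=> -[ltR]; [rewrite binE|rewrite -binE].
move=> ltR; have [k IKE] : exists k, (I + K = R + k.+1)%N.
  by exists (I + K - R).-1; lia.
have IKR : I%:R = R%:R + k%:R + 1 - K%:R :> RT.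
  by have := congr1 (GRing.natmul (1 : RT)) IKE; rewrite !natrD -natr1; lra.
rewrite IKE addKn /= -(ler_nat RT) -muln2 !natrM -natr1 IKR mE.
rewrite [X in _ = (_ <= X)](_ : _ = (k%:R + 1) * k%:R / 2); last by field.
by apply/idP/idP => h; lra.
Qed.
End Bounds.

Theorem proposition1p12 (RT : realType) (I K R : nat)
    (I_gt0 : (0 < I)%N) (K_gt0 : (0 < K)%N) (R_gt0 : (0 < R)%N) :
  let m : int := R%:Z - K%:Z + 2 in
  let bound : Prop :=
    [/\ (2 <= I)%N, (I <= K)%N, (K <= R)%N &
      R%:R <= (2 * I%:R + 2 * K%:R + 1
               - Num.sqrt (8 * K%:R + 8 * I%:R + 1)) / 2 :> RT] in
  let bound' : Prop :=
    [/\ m - 1 <= I%:Z, (I <= K)%N, (K <= R)%N &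
      R%:R <= (I%:R ^+ 2 + (3 - 2 * m%:~R) * I%:R) / 2
              + (m%:~R - 1) * (m%:~R - 2) / 2 :> RT] in
  (bound <-> bound') /\
  (bound -> sfs_cpd_generically_unique_real RT I K R /\
            sfs_cpd_generically_unique_complex RT I K R).
Proof.
move=> m bound bound'.
have bE : bound -> [/\ (2 <= I)%N, (I <= K)%N, (K <= R)%N, (R < I + K)%N
    & (R.*2 <= (I + K - R) * (I + K - R).-1)%N].
  by move=> [I2 IK KR /(square_root_bound_binomial _ _ _ R_gt0)[]].
have n_gt1 n : (R.*2 <= n * n.-1)%N -> (1 < n)%N.
  by case: n => [|[|n]] // leR0; lia.
split.
  split=> [b|[mI IK KR leR]].
    have [I2 IK KR ltR leR] := bE b.
    by have [_ /(_ (conj ltR leR))[]] := quadratic_bound_binomial RT I K R.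
  have [/(_ (conj mI leR))[ltR leR'] _] := quadratic_bound_binomial RT I K R.
  split=> //; last exact/square_root_bound_binomial.
  by have := n_gt1 _ leR'; lia.
move=> /bE[I2 IK KR ltR leR].
have tB (F : fieldType) : thin (@sfs_cpd_not_unique F I K R).
  apply: (@thin_sfs_cpd_not_unique F I K R (I + K - R).-1 (R.+1 - K)); try lia.
  by rewrite prednK ?subn_gt0 // bin2 geq_half_double.
by split; [exact: thin_null_real|exact: thin_null_complex].
Qed.
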